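(* Let $A$ be an Artinian local ring, let $B$ be a finitely generated standard $\mathbb{N}^r$-graded $A$-algebra, and let $M$ be a finitely generated $\mathbb{Z}^r$-graded $B$-module with $\dim(M)=d$. Then: (i) $$e(M^{\mathrm{gr}})=\sum_{\substack{\mathbf n\in\mathbb{Z}^r,\ \mathbf n\ge-\mathbf 1\\ |\mathbf n+\mathbf 1|=d}}e_{\mathbf n}(M).$$ (ii) $\{\mathfrak p\in\mathrm{Supp}(M)\mid\dim(B/\mathfrak p)=d\}\cap V(\mathfrak N)\ne\emptyset$ if and only if $e_{\mathbf n}(M)>0$ for some $\mathbf n\in\mathbb{Z}^r$ with $\mathbf n\ge-\mathbf 1$, $|\mathbf n+\mathbf 1|=d$ and $\mathbf n\not\ge\mathbf 0$.
   Context: $\mathbb{N}=\{0,1,2,\ldots\}$, $r\ge1$. Standard means that $[B]_{\mathbf 0}=A$ and $B$ is generated over $A$ by finitely many elements of degrees $\mathbf e_1,\ldots,\mathbf e_r$ (standard basis vectors). $|\mathbf n|=n_1+\cdots+n_r$, $\mathbf 0=(0,\ldots,0)$, $\mathbf 1=(1,\ldots,1)$; inequalities of vectors are componentwise. $\dim$ is Krull dimension. $\mathfrak N=\bigoplus_{\nu_1>0,\ldots,\nu_r>0}[B]_\nu$ is the irrelevant ideal and $V(\mathfrak N)$ the set of primes of $B$ containing it. Mixed multiplicities via Hilbert series: $\mathrm{Hilb}_M(\mathbf t)=\sum_{\nu\in\mathbb{Z}^r}\mathrm{length}_A([M]_\nu)t_1^{\nu_1}\cdots t_r^{\nu_r}$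 can be written as $\sum_{\mathbf n\in\mathbb{N}^r,|\mathbf n|=d}Q_{\mathbf n}(\mathbf t)/((1-t_1)^{n_1}\cdots(1-t_r)^{n_r})$ with Laurent polynomials $Q_{\mathbf n}\in\mathbb{Z}[t_1^{\pm1},\ldots,t_r^{\pm1}]$, $Q_{\mathbf n}(\mathbf 1)\ge0$, and the values $Q_{\mathbf n}(\mathbf 1)$ do not depend on the choice of decomposition. For $\mathbf n\in\mathbb{Z}^r$ with $\mathbf n\ge-\mathbf 1$ and $|\mathbf n+\mathbf 1|\ge d$, set $e_{\mathbf n}(M)=Q_{\mathbf n+\mathbf 1}(\mathbf 1)$ if $|\mathbf n+\mathbf 1|=d$, and $e_{\mathbf n}(M)=0$ if $|\mathbf n+\mathbf 1|>d$. $M^{\mathrm{gr}}=\bigoplus_{n\in\mathbb{Z}}\big(\bigoplus_{|\nu|=n}[M]_\nu\big)$ is the associated singly graded module over the singly graded $A$-algebra $B^{\mathrm{gr}}$ (defined the same way). Its multiplicity is $e(M^{\mathrm{gr}})=Q(1)$, where $\mathrm{Hilb}_{M^{\mathrm{gr}}}(t)=\sum_n\mathrm{length}_A([M^{\mathrm{gr}}]_n)t^n=Q(t)/(1-t)^d$ with $Q(t)\in\mathbb{Z}[t,t^{-1}]$. *)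

(* Defs.v *)
From HB Require Import structures.
From mathcomp Require Import all_boot all_order all_algebra finmap.
From mathcomp Require Import boolp classical_sets fsbigop.
Set Implicit Arguments.
Unset Strict Implicit.
Unset Printing Implicit Defensive.
Import Order.TTheory GRing.Theory Num.Theory.
Local Open Scope ring_scope.
Local Open Scope classical_set_scope.

(* Membership in subsets of types is given by [{pred T}], as in the library's
   [prime_idealr], [GRing.submod_closed], etc.; via [boolp] every [Prop]-valued
   predicate is of this form. *)

Definition strict_subset (T : Type) (S1 S2 : {pred T}) : Prop :=
  {subset S1 <= S2} /\ exists2 x, x \in S2 & x \notin S1.

(* c 0 < c 1 < ... < c n is a strict chain of members of X, of length n. *)
Definition strict_chain (T : Type) (X : set {pred T}) (n : nat)
    (c : nat -> {pred T}) : Prop :=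
  (forall i, (i <= n)%N -> X (c i)) /\
  (forall i, (i < n)%N -> strict_subset (c i) (c i.+1)).

(* n is the supremum of the lengths of the strict chains in X. In particular
   the supremum is finite and X is nonempty. *)
Definition has_height (T : Type) (X : set {pred T}) (n : nat) : Prop :=
  (exists c, strict_chain X n c) /\
  (forall k c, strict_chain X k c -> (k <= n)%N).

Definition krull_dim (R : comNzRingType) (n : nat) : Prop :=
  has_height [set S : {pred R} | exists p : prime_idealr R, S = p] n.

Definition artinian (R : comNzRingType) : Prop :=
  forall I : nat -> {pred R^o},
    (forall n, GRing.submod_closed (I n)) ->
    (forall n, {subset I n.+1 <= I n}) ->
    exists N, forall n, (N <= n)%N -> I n =i I N.

(* [idealr] only contains proper ideals. *)
Definition maximal_ideal (R : comNzRingType) (m : idealr R) : Prop :=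
  forall J : idealr R, {subset m <= J} -> J =i m.

Definition local_ring (R : comNzRingType) : Prop :=
  exists m : idealr R,
    maximal_ideal m /\ forall m' : idealr R, maximal_ideal m' -> m' =i m.

Section Support.
Variables (B : comNzRingType) (M : lmodType B).

(* Equality of the fractions x.1 / x.2 and y.1 / y.2 in the localization M_p. *)
Definition frac_eq (p : prime_idealr B) (x y : M * B) : Prop :=
  exists2 u, u \notin p & u *: (y.2 *: x.1 - x.2 *: y.1) = 0.

(* p is in Supp M, i.e. M_p <> 0. *)
Definition supp (p : prime_idealr B) : Prop :=
  exists x y : M * B, [/\ x.2 \notin p, y.2 \notin p & ~ frac_eq p x y].

(* dim M is the dimension of Supp M. *)
Definition mod_dim (n : nat) : Prop :=
  has_height [set S : {pred B} | exists2 p : prime_idealr B, supp p & S = p] n.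

Definition mod_finitely_generated : Prop :=
  exists gens : seq M, forall N : {pred M},
    GRing.submod_closed N -> {subset gens <= N} -> forall m, m \in N.

End Support.
Arguments supp {B} M p.
Arguments mod_dim {B} M n.
Arguments mod_finitely_generated {B} M.

Section Grading.
Variables (I : choiceType) (V : zmodType).

(* The sum of the components G i over the indices i satisfying P. *)
Definition sum_components (G : I -> {pred V}) (P : pred I) : {pred V} :=
  fun v => `[< exists (s : seq I) (c : I -> V),
    [/\ all P s, forall i, c i \in G i & v = \sum_(i <- s) c i] >].

(* V is the direct sum of the subgroups G i. *)
Definition direct_sum (G : I -> {pred V}) : Prop :=
  [/\ forall i, GRing.zmod_closed (G i),
      forall v, v \in sum_components G predT
    & forall (s : seq I) (c : I -> V), uniq s -> (forall i, c i \in G i) ->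
        \sum_(i <- s) c i = 0 -> forall i, i \in s -> c i = 0].

End Grading.

Notation Ngr r := {ffun 'I_r -> nat}.
Notation Zgr r := {ffun 'I_r -> int}.

Definition Nstd (r : nat) (i : 'I_r) : Ngr r := [ffun j => (j == i) : nat].

Definition Nadd (r : nat) (m n : Ngr r) : Ngr r := [ffun i => (m i + n i)%N].

Definition NZadd (r : nat) (m : Ngr r) (n : Zgr r) : Zgr r :=
  [ffun i => (m i)%:Z + n i].

(* The n in N^r with |n| = d. *)
Definition Ndegree (r d : nat) : set (Ngr r) :=
  [set n : Ngr r | (\sum_(i < r) n i)%N = d].
Arguments Ndegree : clear implicits.

Section GradedAlgebra.
Variables (r : nat) (A : comNzRingType) (B : comAlgType A).
Variable (Bgr : Ngr r -> {pred B}).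

Definition graded_ring : Prop :=
  [/\ direct_sum Bgr, 1 \in Bgr [ffun=> 0%N]
    & forall m n x y, x \in Bgr m -> y \in Bgr n -> x * y \in Bgr (Nadd m n)].

Definition standard : Prop :=
  [/\ injective (fun a : A => a%:A : B),
      forall b, b \in Bgr [ffun=> 0%N] <-> exists a : A, b = a%:A
    & exists gens : seq B,
        (forall b, b \in gens -> exists i, b \in Bgr (Nstd i)) /\
        (forall S : {pred B}, GRing.subalg_closed S -> {subset gens <= S} ->
           forall b, b \in S)].

Definition irrelevant : {pred B} :=
  sum_components Bgr (fun n => [forall i, (0 < n i)%N]).

Definition V_irrelevant (p : prime_idealr B) : Prop :=
  {subset irrelevant <= p}.

Variable (M : lmodType B).

Definition graded_module (Mgr : Zgr r -> {pred M}) : Prop :=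
  direct_sum Mgr /\
  forall m n b x, b \in Bgr m -> x \in Mgr n -> b *: x \in Mgr (NZadd m n).

(* M viewed as an A-module by restriction of scalars. *)
Definition A_submodule (N : {pred M}) : Prop :=
  0 \in N /\
  forall (a : A) (x y : M), x \in N -> y \in N -> (a%:A : B) *: x + y \in N.

(* Length over A of an A-submodule V of M (junk value 0 if it is infinite). *)
Definition lengthA (V : {pred M}) : nat :=
  xget 0%N [set n | has_height
    [set N : {pred M} | A_submodule N /\ {subset N <= V}] n].

End GradedAlgebra.

Notation laurent I := {fsfun I -> int with 0}.

(* Q(1, ..., 1). *)
Definition laurent1 (I : choiceType) (Q : laurent I) : int :=
  \sum_(m <- finsupp Q) Q m.

(* Coefficient of t ^ k in the expansion of 1 / (1 - t) ^ n in powers of t;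
   by truncated subtraction, it is 1 for k = 0 and 0 for k > 0 when n = 0. *)
Definition inv_coef (n : nat) (k : int) : nat :=
  if k is Posz j then 'C((j + n).-1, j) else 0%N.

Section MixedMultiplicity.
Variables (r : nat) (H : Zgr r -> nat) (d : nat).

(* Coefficient of t ^ nu in Q(t) / ((1 - t_1)^(n_1) ... (1 - t_r)^(n_r)). *)
Definition frac_coef (Q : laurent (Zgr r)) (n : Ngr r) (nu : Zgr r) : int :=
  \sum_(m <- finsupp Q) Q m * (\prod_(i < r) inv_coef (n i) (nu i - m i))%:Z.

Definition hilb_decomposition (Q : Ngr r -> laurent (Zgr r)) : Prop :=
  (forall n, Ndegree r d n -> 0 <= laurent1 (Q n)) /\
  forall nu, (H nu)%:Z =
    \sum_(n \in Ndegree r d) frac_coef (Q n) n nu.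

Definition ge_vec (n : Zgr r) (c : int) : Prop := forall i, c <= n i.

(* |n + 1|, where 1 = (1, ..., 1). *)
Definition total_succ (n : Zgr r) : int := \sum_(i < r) (n i + 1).

Definition mixed_index : set (Zgr r) :=
  [set n : Zgr r | ge_vec n (-1) /\ total_succ n = d%:Z].

Definition succ_vec (n : Zgr r) : Ngr r := [ffun i => absz (n i + 1)].

(* e_n, relevant for n >= -1 and |n + 1| >= d. The value Q_{n+1}(1) does not
   depend on the decomposition Q. *)
Definition mixed_mult (n : Zgr r) : int :=
  if total_succ n == d%:Z then
    xget 0 [set e | exists2 Q, hilb_decomposition Q
                             & e = laurent1 (Q (succ_vec n))]
  else 0.

End MixedMultiplicity.
Arguments mixed_index : clear implicits.

(* Q(1), where sum_n H(n) t ^ n = Q(t) / (1 - t) ^ d. *)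
Definition multiplicity (H : int -> nat) (d : nat) : int :=
  xget 0 [set e | exists2 Q : laurent int,
    forall nu : int, (H nu)%:Z =
      \sum_(m <- finsupp Q) Q m * (inv_coef d (nu - m))%:Z
  & e = laurent1 Q].

Section ModuleMultiplicities.
Variables (r : nat) (A : comNzRingType) (B : comAlgType A) (M : lmodType B).
Variables (Mgr : Zgr r -> {pred M}) (d : nat).

Definition hilb (nu : Zgr r) : nat := lengthA (Mgr nu).

(* The graded components of M^gr. *)
Definition total_grading (n : int) : {pred M} :=
  sum_components Mgr (fun nu => \sum_(i < r) nu i == n).

Definition hilb_gr (n : int) : nat := lengthA (total_grading n).

(* In both definitions, d stands for the dimension of M. *)
Definition mixed_multiplicity (n : Zgr r) : int := mixed_mult hilb d n.

Definition multiplicity_gr : int := multiplicity hilb_gr d.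

End ModuleMultiplicities.

(* Main.v *)
(* M has a finite filtration by graded submodules with factors N''/N' = B m, where
   m is homogeneous and q = (N' : m) is prime.  If q contains all B_{e_j}, the
   factor has length 1.  Otherwise multiplication by some x in B_{e_j} outside q
   gives (1 - t_j) Hilb(N''/N') = Hilb(N''/(N' + B x m)), and the support of the
   latter has smaller dimension.  Noetherian induction on N' thus expresses the
   Hilbert series as a sum of terms c t^m / (1-t)^n with |n| = d, and the sum of
   the c at each n is nonnegative and depends only on the series.  The same terms
   with all t_i = t give the series of M^gr, hence (i).

   For (ii), a prime contains the irrelevant ideal iff it contains some B_{e_i}.
   If a factor B/q of dimension d does not contain B_{e_i}, choosing j = i gives
   n_i >= 1 in all its terms; if it does, then j <> i always, so only n_i = 0
   occurs with a nonzero total coefficient.  The coefficients cannot all vanish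
   because a chain of (possibly inhomogeneous) primes q = p_0 < ... < p_d forces
   the cumulative Hilbert function to grow like K^d: for x in p_1 \ p_0 of degree
   at most a, the filtered pieces satisfy
   h_{p_0}(K + a) >= h_{p_0}(K) + h_{p_1}(K + a). *)
Require Import Defs.
From HB Require Import structures.
From mathcomp Require Import all_boot all_order all_algebra finmap.
From mathcomp Require Import zify.
From mathcomp Require Import boolp classical_sets fsbigop.
Set Implicit Arguments.
Unset Strict Implicit.
Unset Printing Implicit Defensive.
Import Order.TTheory GRing.Theory Num.Theory.
Local Open Scope ring_scope.
Local Open Scope classical_set_scope.

(** * Submodules and composition series *)

(** The filtration is never formed: noetherian induction on the lower submodule yields the formal
    sum together with composition series of the A-submodules cut out by sets of degrees. One formal
    sum must describe three Hilbert functions: in single degrees (mixed multiplicities), in total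
    degrees ([M^gr]) and in total degrees up to a bound (growth). So the claim is made for every
    [window], a family of degree sets bounded above and closed under translation, which is all that
    multiplication by x uses. Only an upper bound d of the dimension is carried along; it drops by
    one at each multiplication by x, because chains from a prime strictly above q extend by one down
    to q. A residue field met while the bound is still positive is brought to the right degree by
    multiplying numerator and denominator by 1 - t_j; the new terms cancel at every n. The primes of
    a chain may be inhomogeneous, while the induction meets homogeneous ones only. That the bound is
    attained is therefore detected by growth. For (ii) the formal sum is built for one index i; its
    weights do not depend on i, since the series determines them. *)

Section Submodules.
Variables (R : comNzRingType) (M : lmodType R) (O : set R).
Implicit Types U V W C N : set M.

(* Ideals (M = R), B-submodules (O = setT) and A-submodules of a B-module
   (O = the image of A) are all instances. *)
Definition opsub U : Prop :=
  [/\ U 0, forall x y, U x -> U y -> U (x - y)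
    & forall b x, O b -> U x -> U (b *: x)].

Lemma opsub0 U : opsub U -> U 0. Proof. by case. Qed.
Lemma opsubB U x y : opsub U -> U x -> U y -> U (x - y).
Proof. by case=> _ h _; apply: h. Qed.
Lemma opsubZ U b x : opsub U -> O b -> U x -> U (b *: x).
Proof. by case=> _ _; apply. Qed.
Lemma opsubN U x : opsub U -> U x -> U (- x).
Proof. by move=> sU Ux; rewrite -sub0r; apply: opsubB => //; apply: opsub0. Qed.
Lemma opsubD U x y : opsub U -> U x -> U y -> U (x + y).
Proof. by move=> sU Ux Uy; rewrite -[y]opprK; apply: opsubB => //; apply: opsubN. Qed.
Lemma opsub_addr U x y : opsub U -> U y -> U (x + y) -> U x.
Proof. by move=> sU Uy Uxy; rewrite -[x](addrK y); apply: opsubB. Qed.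
Lemma opsub_sum U (I : Type) (s : seq I) (P : pred I) (F : I -> M) :
  opsub U -> (forall i, P i -> U (F i)) -> U (\sum_(i <- s | P i) F i).
Proof.
by move=> sU h; elim/big_ind: _ => //; [apply: opsub0|move=> x y; apply: opsubD].
Qed.

Lemma opsubI U V : opsub U -> opsub V -> opsub (U `&` V).
Proof.
move=> sU sV; split; first by split; apply: opsub0.
- by move=> x y [? ?] [? ?]; split; apply: opsubB.
- by move=> b x Ob [? ?]; split; apply: opsubZ.
Qed.

Lemma opsub_set0 : opsub [set 0].
Proof.
split=> //= [x y -> ->|b x _ ->]; [by rewrite subrr|by rewrite scaler0].
Qed.

Lemma opsub_setT : opsub setT. Proof. by []. Qed.

Definition addm U V : set M := [set z | exists x y, [/\ U x, V y & z = x + y]].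

Lemma addmP U V x y : U x -> V y -> addm U V (x + y).
Proof. by move=> Ux Vy; exists x, y. Qed.
Lemma addml U V : V 0 -> U `<=` addm U V.
Proof. by move=> V0 x Ux; rewrite -[x]addr0; apply: addmP. Qed.
Lemma addmr U V : U 0 -> V `<=` addm U V.
Proof. by move=> U0 x Vx; rewrite -[x]add0r; apply: addmP. Qed.
Lemma addm_sub U V W : opsub W -> U `<=` W -> V `<=` W -> addm U V `<=` W.
Proof. by move=> sW UW VW z [x [y [/UW Ux /VW Vy ->]]]; apply: opsubD. Qed.
Lemma opsub_addm U V : opsub U -> opsub V -> opsub (addm U V).
Proof.
move=> sU sV; split; first by rewrite -[0]addr0; apply: addmP; apply: opsub0.
- move=> _ _ [x [y [Ux Vy ->]]] [x' [y' [Ux' Vy' ->]]].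
  by rewrite opprD addrACA; apply: addmP; apply: opsubB.
- by move=> b _ Ob [x [y [Ux Vy ->]]]; rewrite scalerDr; apply: addmP; apply: opsubZ.
Qed.

(** Quotient modules are never formed: a factor V / U is handled as the pair of its ends. *)
Definition simple U V : Prop :=
  [/\ opsub U, opsub V, U `<=` V, ~ (V `<=` U)
    & forall C, opsub C -> U `<=` C -> C `<=` V -> C `<=` U \/ V `<=` C].

Inductive comp_series : set M -> set M -> nat -> Prop :=
| comp_series0 U : opsub U -> comp_series U U 0
| comp_seriesS U V W n : simple U V -> comp_series V W n -> comp_series U W n.+1.

(* The last member of the chain may be smaller than V. *)
Inductive sub_chain : set M -> set M -> nat -> Prop :=
| sub_chain0 U V : U `<=` V -> sub_chain U V 0
| sub_chainS U C V n : opsub C -> U `<=` C -> ~ (C `<=` U) -> sub_chain C V n ->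
  sub_chain U V n.+1.

Lemma comp_series_sub U V n : comp_series U V n -> [/\ opsub U, opsub V & U `<=` V].
Proof.
elim=> [W sW|U' V' W k [sU sV UV _ _] _ [_ sW VW]]; first by split.
by split=> //; apply: subset_trans VW.
Qed.

Lemma comp_series_eq U U' V V' n : U = U' -> V = V' -> comp_series U V n ->
  comp_series U' V' n.
Proof. by move=> -> ->. Qed.

Lemma comp_series_cat U V W n m : comp_series U V n -> comp_series V W m ->
  comp_series U W (n + m).
Proof. by elim=> [//|U' V' W' k sU _ IH /IH]; rewrite addSn; apply: comp_seriesS. Qed.

Lemma comp_series1 U V : simple U V -> comp_series U V 1.
Proof. by move=> s; apply: (comp_seriesS s); apply: comp_series0; case: s. Qed.

Lemma sub_chain_subset U V k : sub_chain U V k -> U `<=` V.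
Proof. by elim=> // U' C V' n _ UC _ _; apply: subset_trans. Qed.

Lemma sub_chainW U U' V k : U' `<=` U -> sub_chain U V k -> sub_chain U' V k.
Proof.
move=> UU' h; case: h UU' => [U1 V1 UV UU'|U1 C V1 n sC UC nCU h UU'].
  by apply: sub_chain0; apply: subset_trans UV.
apply: (sub_chainS sC) h; first exact: subset_trans UC.
by move=> CU'; apply: nCU; apply: subset_trans UU'.
Qed.

Lemma sub_chain_widen U V V' k : V `<=` V' -> sub_chain U V k -> sub_chain U V' k.
Proof.
move=> VV' h; elim: h VV' => [U1 V1 UV VV'|U1 C V1 n sC UC nCU _ IH VV'].
  by apply: sub_chain0; apply: subset_trans VV'.
by apply: (sub_chainS sC) => //; apply: IH.
Qed.

Lemma sub_chain_cat U V W n m : sub_chain U V n -> sub_chain V W m ->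
  sub_chain U W (n + m).
Proof.
elim=> [U1 V1 UV|U1 C V1 k sC UC nCU _ IH /IH]; first exact: sub_chainW.
by rewrite addSn; apply: sub_chainS.
Qed.

(* A chain loses at most one step when joined with a simple extension. *)
Lemma sub_chain_simple U U1 C V k : simple U U1 -> opsub C -> U `<=` C -> U1 `<=` V ->
  opsub V -> ~ (U1 `<=` C) -> sub_chain C V k.+1 -> sub_chain (addm C U1) V k.
Proof.
move=> [sU sU1 UU1 _ simp] + + UV sV.
elim: k C => [|k IH] C sC UC nUC h; inversion h as [|U' C1 V' n sC1 CC1 nC1C h1].
  by apply: sub_chain0; apply: addm_sub => //;
    apply: subset_trans (sub_chain_subset h1).
subst; have [U1C1|nU1C1] := pselect (U1 `<=` C1).
  by apply: sub_chainW h1; apply: addm_sub.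
apply: (sub_chainS (C := addm C1 U1)); first exact: opsub_addm.
- by move=> z [x [y [Cx Uy ->]]]; apply: addmP => //; apply: CC1.
- move=> sCC; apply: nC1C => c Cc.
  have [x [y [Cx Uy e]]] : addm C U1 c by apply/sCC/addml => //; apply: opsub0.
  (* Modular law: c = x + y with y in the intersection of C1 and U1, which lies between U and U1;
     simplicity puts it inside U, hence inside C, or puts U1 inside C1. *)
  have [||h'|h'] := simp (C1 `&` U1) (opsubI sC1 sU1).
  + by move=> z Uz; split; [apply/CC1/UC|apply: UU1].
  + by move=> ? [].
  + rewrite e; apply: opsubD => //; apply/UC/h'; split=> //.
    by apply: (@opsub_addr _ y x) => //; [apply: CC1|rewrite addrC -e].
  + by case: nU1C1 => z /h' [].
- by apply: IH => //; apply: subset_trans CC1.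
Qed.

(** The Jordan-Hoelder bound, by induction on the series: joining a chain with the first simple step
    costs it at most one member. It identifies the length of a composition series with the supremum
    over all chains. *)
Lemma comp_series_bound U V n k : comp_series U V n -> sub_chain U V k -> (k <= n)%N.
Proof.
move=> h; elim: h k => [W sW|U' V' W m simp csV IH] [|k] //.
  move=> h; inversion h as [|U1 C V1 j sC UC nCU h1]; subst.
  by case: nCU; apply: sub_chain_subset h1.
have [sU sV UV nVU _] := simp; have [_ sW VW] := comp_series_sub csV.
move=> /(sub_chain_simple simp sU (@subset_refl _ U') VW sW nVU) h.
by rewrite ltnS; apply: IH; apply: sub_chainW h; apply: addmr; apply: opsub0.
Qed.

Definition acc W : Prop := forall N : nat -> set M,
  (forall i, opsub (N i)) -> (forall i, N i `<=` W) ->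
  (forall i, N i `<=` N i.+1) -> exists k, forall i, (k <= i)%N -> N i `<=` N k.

Lemma chain_mono (T : Type) (N : nat -> set T) : (forall i, N i `<=` N i.+1) ->
  forall i j, (i <= j)%N -> N i `<=` N j.
Proof.
move=> NS i j /subnK <-; elim: (j - i)%N => [//|k IH].
by rewrite addSn; apply: subset_trans (NS _).
Qed.

(** Dependent choice: every counterexample has a strictly larger one, and these would form an
    ascending chain that never stabilizes. *)
Lemma acc_ind W (P : set M -> Prop) : acc W ->
  (forall N, opsub N -> N `<=` W ->
    (forall N', opsub N' -> N' `<=` W -> N `<=` N' -> ~ (N' `<=` N) -> P N') ->
    P N) ->
  forall N, opsub N -> N `<=` W -> P N.
Proof.
move=> accW step N sN NW; apply: contrapT => nPN.
pose bad := {N | [/\ opsub N, N `<=` W & ~ P N]}.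
have next (b : bad) : {b' : bad | sval b `<=` sval b' /\ ~ (sval b' `<=` sval b)}.
  apply: cid; case: b => N1 [s1 w1 b1] /=; apply: contrapT => h; apply: b1.
  apply: step => // N' sN' wN' NN' nNN'; apply: contrapT => nP; apply: h.
  by exists (exist _ N' (And3 sN' wN' nP)).
pose f := fix f n : bad :=
  if n is k.+1 then sval (next (f k)) else exist _ N (And3 sN NW nPN).
have [|||k hk] := accW (fun i => sval (f i)).
- by move=> i; case: (svalP (f i)).
- by move=> i; case: (svalP (f i)).
- by move=> i; case: (svalP (next (f i))).
by case: (svalP (next (f k))) => _; apply; apply: (hk k.+1).
Qed.

Lemma acc_max W (Q : set M -> Prop) : acc W ->
  (exists2 N, opsub N /\ N `<=` W & Q N) ->
  exists N, [/\ opsub N, N `<=` W, Q N &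
    forall N', opsub N' -> N' `<=` W -> Q N' -> N `<=` N' -> N' `<=` N].
Proof.
move=> accW [N [sN NW]]; move: N sN NW.
apply: (acc_ind accW) => N sN NW IH QN.
have [[N' [s' w' q' [NN' nNN']]]|h] := pselect (exists N', [/\ opsub N', N' `<=` W,
  Q N' & N `<=` N' /\ ~ (N' `<=` N)]).
  exact: (IH N').
exists N; split=> // N' s' w' q' NN'; apply: contrapT => nNN'; apply: h.
by exists N'.
Qed.

Lemma bounded_acc W n : opsub W -> (forall k, sub_chain [set 0] W k -> (k <= n)%N) ->
  acc W.
Proof.
move=> sW bnd N sN NW NS; apply: contrapT => h.
have h' k : exists2 i, (k <= i)%N & ~ (N i `<=` N k).
  apply: contrapT => nk; apply: h; exists k => i ki; apply: contrapT => ?.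
  by apply: nk; exists i.
suff : forall k i, sub_chain (N i) W k.
  move=> /(_ n.+1 0%N) c; suff /bnd : sub_chain [set 0] W n.+1 by rewrite ltnn.
  by apply: sub_chainW c => _ ->; apply: opsub0.
elim=> [i|k IH i]; first exact: sub_chain0.
by have [j ij nj] := h' i; apply: sub_chainS nj (IH j) => //; apply: chain_mono.
Qed.

End Submodules.

(** * Series and chains along a linear map *)

Section Transport.
Variables (R : comNzRingType) (M M' : lmodType R) (O : set R) (f : M -> M').
Hypothesis fB : forall x y, f (x - y) = f x - f y.
Hypothesis fZ : forall b x, f (b *: x) = b *: f x.

Lemma transport0 : f 0 = 0. Proof. by rewrite -(subrr 0) fB subrr. Qed.

Lemma opsub_image U : opsub O U -> opsub O (f @` U).
Proof.
move=> sU; split; first by exists 0; [apply: opsub0 sU|apply: transport0].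
- by move=> _ _ [x Ux <-] [y Uy <-]; rewrite -fB; exists (x - y) => //;
  apply: (opsubB sU).
- by move=> b _ Ob [x Ux <-]; rewrite -fZ; exists (b *: x) => //; apply: (opsubZ sU).
Qed.

Lemma opsub_preim V U : opsub O V -> opsub O U -> opsub O (V `&` f @^-1` U).
Proof.
move=> sV sU; split; first by split; [apply: opsub0 sV|rewrite /= transport0;
  apply: opsub0 sU].
- move=> x y [Vx Ux] [Vy Uy]; split; first exact: (opsubB sV).
  by rewrite /= fB; apply: (opsubB sU).
- move=> b x Ob [Vx Ux]; split; first exact: (opsubZ sV).
  by rewrite /= fZ; apply: (opsubZ sU).
Qed.

(** The last two hypotheses say that f induces an injection of V / U into M' / U', whose image is
    (U' + f V) / U'. Series and chains are pushed under the same hypotheses. *)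
Lemma simple_push U V U' : simple O U V -> opsub O U' ->
  f @` U `<=` U' -> (forall v, V v -> U' (f v) -> U v) ->
  simple O U' (addm U' (f @` V)).
Proof.
move=> [sU sV UV nVU simp] sU' fU fV.
have s1 := opsub_image sV; split=> //; first exact: opsub_addm.
- by apply: addml; apply: (opsub0 s1).
- move=> h; apply: nVU => v Vv; apply: fV => //; apply/h/addmr; first exact: opsub0 sU'.
  by exists v.
move=> C sC UC CV.
have [|||h|h] := simp (V `&` f @^-1` C); first exact: opsub_preim.
- by move=> u Uu; split; [apply: UV|apply/UC/fU; exists u].
- by move=> ? [].
- left=> c Cc; have [u [_ [Uu [v Vv <-] e]]] := CV _ Cc; rewrite e.
  apply: (opsubD sU') => //; apply: fU; exists v => //; apply: h; split=> //=.
  by apply: (opsub_addr (y := u) sC); [apply: UC|rewrite addrC -e].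
- right; apply: (addm_sub sC UC) => _ [v /h [_ Cv] <-] //.
Qed.

Lemma comp_series_push U V n U' : comp_series O U V n -> opsub O U' ->
  f @` U `<=` U' -> (forall v, V v -> U' (f v) -> U v) ->
  comp_series O U' (addm U' (f @` V)) n.
Proof.
move=> h; elim: h U' => {U V n} [U sU|U V W n simp csV IH] U' sU' fU fV.
  rewrite (_ : addm _ _ = U'); first exact: comp_series0.
  apply/seteqP; split; first exact: (addm_sub sU' (@subset_refl _ U') fU).
  by apply: addml; apply: (opsub0 (opsub_image sU)).
have [sU sV UV nVU _] := simp; have [_ sW VW] := comp_series_sub csV.
have fV' v : V v -> U' (f v) -> U v by move=> /VW; apply: fV.
apply: (comp_seriesS (simple_push simp sU' fU fV')).
rewrite (_ : addm U' (f @` W) = addm (addm U' (f @` V)) (f @` W)).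
  apply: IH; first by apply: opsub_addm => //; apply: opsub_image.
    by apply: addmr; apply: opsub0 sU'.
  move=> w Ww [u [_ [Uu [v Vv <-] e]]].
  have h : U (w - v).
    apply: fV; first by apply: (opsubB sW) => //; apply: VW.
    by rewrite fB e addrK.
  by rewrite -[w](subrK v); apply: (opsubD sV) => //; apply: UV.
apply/seteqP; split.
  move=> _ [x [y [Ux Wy ->]]]; apply: addmP => //.
  by apply: addml => //; apply: (opsub0 (opsub_image sV)).
apply: (addm_sub (opsub_addm sU' (opsub_image sW))).
  by move=> _ [x [_ [Ux [v Vv <-] ->]]]; apply: addmP => //; exists v => //; apply: VW.
by apply: addmr; apply: opsub0 sU'.
Qed.

Lemma comp_series_pull V U' V' n : opsub O V -> comp_series O U' V' n ->
  V' `<=` addm U' (f @` V) ->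
  comp_series O (V `&` f @^-1` U') (V `&` f @^-1` V') n.
Proof.
move=> sV; elim=> {U' V' n} [U sU|U W W' n simp csW IH] W'V.
  by move=> *; apply: comp_series0; apply: opsub_preim.
have [sU sW UW nWU simp'] := simp; have [_ sW' WW'] := comp_series_sub csW.
apply: (@comp_seriesS _ _ _ _ (V `&` f @^-1` W)); last first.
  apply: IH => w /W'V [u [_ [Uu [v Vv <-] ->]]].
  by apply: addmP; [apply: UW|exists v].
split; do ?exact: opsub_preim.
- by move=> v [Vv Uv]; split=> //; apply: UW.
- move=> h; apply: nWU => w Ww; have [u [_ [Uu [v Vv <-] e]]] := W'V _ (WW' _ Ww).
  rewrite e; apply: (opsubD sU) => //; case: (h v) => //; split=> //=.
  by apply: (opsub_addr (y := u) sW); [apply: UW|rewrite addrC -e].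
move=> C sC UC CW.
have s2 := opsub_image sC.
have [|||h|h] := simp' (addm U (f @` C)); first exact: opsub_addm.
- by apply: addml; apply: (opsub0 s2).
- by apply: (addm_sub sW UW) => _ [c /CW [_ Wc] <-].
- left=> c Cc; split; first by case: (CW _ Cc).
  by apply: h; apply: (addmr (opsub0 sU)); exists c.
- right=> v [Vv Wv]; have [u [_ [Uu [c Cc <-] e]]] := h _ Wv.
  rewrite -[v](subrK c); apply: (opsubD sC) => //; apply: UC; split.
    by apply: (opsubB sV) => //; case: (CW _ Cc).
  by rewrite /= fB e addrK.
Qed.

Lemma sub_chain_push U V k U' : sub_chain O U V k -> opsub O U -> opsub O V ->
  opsub O U' ->
  f @` U `<=` U' -> (forall v, V v -> U' (f v) -> U v) ->
  sub_chain O U' (addm U' (f @` V)) k.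
Proof.
move=> h; elim: h U' => {U V k} [U V UV|U C V k sC UC nCU hC IH] U' sU sV sU' fU fV.
  by apply/sub_chain0/addml; exists 0; [apply/UV/(opsub0 sU)|apply: transport0].
have s2 := opsub_image sC; have CV := sub_chain_subset hC.
apply: (@sub_chainS _ _ _ _ (addm U' (f @` C))); first exact: opsub_addm.
- exact/addml/(opsub0 s2).
- move=> h; apply: nCU => c Cc; apply: fV; first exact: CV.
  by apply/h/(addmr (opsub0 sU')); exists c.
apply: (@sub_chain_widen _ _ _ _ (addm (addm U' (f @` C)) (f @` V))).
  move=> _ [_ [y [[u [_ [Uu [c Cc <-] ->]]] [v Vv <-] ->]]].
  rewrite -addrA; apply: addmP => //; exists (c + v); last first.
    by have := fB (c + v) v; rewrite addrK => ->; rewrite subrK.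
  by apply: (opsubD sV) => //; apply: CV.
apply: IH => //; first exact: opsub_addm.
- exact/(addmr (opsub0 sU')).
- move=> v Vv [u [_ [Uu [c Cc <-] e]]]; rewrite -[v](subrK c).
  apply: (opsubD sC) => //; apply: UC; apply: fV; last by rewrite fB e addrK.
  by apply: (opsubB sV) => //; apply: CV.
Qed.

End Transport.

(** * Artinian rings and noetherian modules *)

Definition pred_of (T : Type) (U : set T) : {pred T} := fun x => `[< U x >].

Lemma pred_ofP (T : Type) (U : set T) x : reflect (U x) (x \in pred_of U).
Proof. exact: asboolP. Qed.

Lemma opsub_submod (R : comNzRingType) (M : lmodType R) (U : set M) :
  opsub setT U -> GRing.submod_closed (pred_of U).
Proof.
move=> sU; split; first exact/pred_ofP/(opsub0 sU).
move=> a x y /pred_ofP Ux /pred_ofP Uy; apply/pred_ofP.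
by apply: (opsubD sU) => //; apply: (opsubZ sU).
Qed.

Section Artinian.
Variables (A : comNzRingType).
Hypothesis artA : artinian A.
Notation subA := (@opsub A A^o setT).

Lemma artinian_min (Q : set A^o -> Prop) : (exists2 N, subA N & Q N) ->
  exists N, [/\ subA N, Q N &
    forall N', subA N' -> Q N' -> N' `<=` N -> N `<=` N'].
Proof.
move=> [N sN QN]; apply: contrapT => h.
pose bad := {N | subA N /\ Q N}.
have next (b : bad) : {b' : bad | sval b' `<=` sval b /\ ~ (sval b `<=` sval b')}.
  apply: cid; case: b => N1 [s1 q1] /=; apply: contrapT => h1; apply: h.
  exists N1; split=> // N' s' q' N'N; apply: contrapT => nN; apply: h1.
  by exists (exist _ N' (conj s' q')).
pose f := fix f n : bad :=
  if n is k.+1 then sval (next (f k)) else exist _ N (conj sN QN).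
have [||k hk] := artA (I := fun i => pred_of (sval (f i))).
- by move=> i; apply: opsub_submod; case: (svalP (f i)).
- move=> i x /pred_ofP Ux; apply/pred_ofP; move: x Ux.
  by case: (svalP (next (f i))).
case: (svalP (next (f k))) => _; apply=> x fx.
by apply/pred_ofP; rewrite (hk k.+1) //; apply/pred_ofP.
Qed.

Lemma artinian_pow (a : A) : exists k b, a ^+ k = a ^+ k.+1 * b.
Proof.
have sI k : subA [set x | exists b : A, x = a ^+ k * b].
  split; first by exists 0; rewrite mulr0.
  - by move=> _ _ [b ->] [c ->]; exists (b - c); rewrite mulrBr.
  - by move=> b _ _ [c ->]; exists (b * c); rewrite /= [LHS]mulrCA.
have [|N [sN [k eN] minN]] := artinian_min (Q := fun N => exists k,
   N = [set x | exists b : A, x = a ^+ k * b]).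
  by eexists; [apply: (sI 0%N)|exists 0%N].
have [|||b e] := minN _ (sI k.+1) _ _ (a ^+ k).
- by exists k.+1.
- by rewrite eN => _ [b ->]; exists (a * b); rewrite mulrA -exprSr.
- by rewrite eN; exists 1; rewrite mulr1.
- by exists k, b.
Qed.

(** Take I minimal among the ideals without a composition series. Multiplication by any x kills I or
    maps I onto itself, as otherwise its kernel and image on I would have finite length, and so
    would I. An x that does not kill I thus acts invertibly, and I behaves like a vector space: a
    subideal J maximal among those avoiding some nonzero x0 has finite length, and I / J is simple,
    a contradiction. *)
Lemma artinian_length : exists n, @comp_series A A^o setT [set 0] setT n.
Proof.
apply: contrapT => nfl.
pose fl U := exists n, @comp_series A A^o setT [set 0] U n.
have s00 : subA [set 0] := opsub_set0 _ _.
have [|I [sI nI minI]] := artinian_min (Q := fun N => ~ fl N).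
  by exists setT => //; apply: opsub_setT.
have flI J : subA J -> J `<=` I -> ~ (I `<=` J) -> fl J.
  by move=> sJ JI nIJ; apply: contrapT => /(minI _ sJ) /(_ JI).
have dich (x : A) : (forall v, I v -> x *: v = 0) \/
    (forall w, I w -> exists2 v, I v & w = x *: v).
  apply: contrapT => /not_orP [h1 h2].
  pose f (v : A^o) := x *: v.
  have fB u v : f (u - v) = f u - f v by apply: scalerBr.
  have fZ (b : A) u : f (b *: u) = b *: f u by rewrite /f !scalerA mulrC.
  have [|n cn] := flI _ (opsubI sI (opsub_preim fB fZ (opsub_setT _ _) s00))
    (@subIsetl _ _ _).
    by move=> h; apply: h1 => v /h [_ []].
  have [||m cm] := flI _ (opsub_image fB fZ sI).
  - by move=> _ [v Iv <-]; apply: (opsubZ sI).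
  - by move=> h; apply: h2 => w /h [v Iv <-]; exists v.
  apply: nI; exists (n + m)%N; apply: comp_series_cat cn _.
  apply: (comp_series_eq _ _ (comp_series_pull fB fZ sI cm _)).
  - by rewrite setTI.
  - by apply/seteqP; split=> [v []//|v Iv]; split=> //=; exists v.
  - by apply: addmr.
have inv (a : A) : (forall w, I w -> exists2 v, I v & w = a *: v) ->
    exists b : A, forall y, I y -> y = b *: (a *: y).
  move=> aI; have [k [b e]] := artinian_pow a; exists b => y Iy.
  have [z Iz ->] : exists2 z, I z & y = a ^+ k *: z.
    elim: k {e} y Iy => [|k IH] y Iy; first by exists y; rewrite ?scale1r.
    have [v Iv ->] := aI _ Iy; have [z Iz ->] := IH _ Iv.
    by exists z; rewrite // scalerA -exprS.
  by rewrite !scalerA; congr (_ *: _); rewrite {1}e exprS mulrC mulrA.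
have [x0 Ix0 nx0] : exists2 x0, I x0 & x0 <> 0.
  apply: contrapT => h; apply: nI; exists 0%N.
  rewrite (_ : I = [set 0]); first exact: comp_series0.
  apply/seteqP; split=> x /=; last by move=> ->; apply: opsub0 sI.
  by move=> Ix; apply: contrapT => nx; apply: h; exists x.
(* The union of the empty chain is empty, so Zorn's lemma is applied to sets that become ideals once
   0 is added. *)
have [F FP totF|J0 [[sJ JI nJ] maxJ]] := @Zorn_bigcup A^o
    [set X | [/\ subA (X `|` [set 0]), X `<=` I & ~ X x0]].
  split; last 2 first.
  - by move=> x [X /FP [_ h _]]; apply: h.
  - by move=> [X /FP [_ _]].
  split; first by right.
  - move=> x y [[X FX Xx]|/= ->] [[Y FY Yy]|/= ->]; rewrite ?subr0 ?sub0r.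
    + wlog [Z FZ [Zx Zy]] : / exists2 Z, F Z & Z x /\ Z y.
        apply; case: (totF X Y FX FY) => h.
          by exists Y => //; split=> //; apply: h.
        by exists X => //; split=> //; apply: h.
      have [sZ _ _] := FP _ FZ.
      by case: (opsubB sZ (or_introl Zx) (or_introl Zy)) => h; [left; exists Z|right].
    + by left; exists X.
    + have [sZ _ _] := FP _ FY.
      by case: (opsubN sZ (or_introl Yy)) => h; [left; exists Y|right].
    + by right.
  - move=> b x _ [[X FX Xx]|/= ->]; last by right; rewrite /= scaler0.
    have [sZ _ _] := FP _ FX.
    by case: (opsubZ (b := b) sZ Logic.I (or_introl Xx)) => h; [left; exists X|right].
set J : set A^o := J0 `|` [set 0] in sJ.
have {}nJ : ~ J x0 by case.
have {}JI : J `<=` I by move=> x [/JI//|/= ->]; apply: opsub0 sI.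
have {}maxJ C : subA C -> J `<=` C -> C `<=` I -> ~ C x0 -> C `<=` J.
  move=> sC JC CI nC; apply: contrapT => nCJ.
  apply: (maxJ C); last by split=> //; rewrite (_ : _ `|` _ = C) //;
    apply/seteqP; split=> x; [case=> // ->; apply: opsub0 sC|left].
  split; first by move=> x J0x; apply: JC; left.
  by move=> h; apply: nCJ => x /h; left.
have [//|n cn] := flI _ sJ JI; first by move=> h; apply/nJ/h.
apply: nI; exists (n + 1)%N; apply: comp_series_cat cn (comp_series1 _).
split=> //; first by move=> h; apply/nJ/h.
move=> C sC JC CI; have [Cx0|nCx0] := pselect (C x0); last by left; apply: maxJ.
right=> y Iy; have [Jy|nJy] := pselect (J y); first exact: JC.
pose Ay : set A^o := [set z | exists a : A, z = a *: (y : A^o)].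
have sAy : subA Ay.
  split; first by exists 0; rewrite scale0r.
  - by move=> _ _ [b ->] [c ->]; exists (b - c); rewrite scalerBl.
  - by move=> b _ _ [c ->]; exists (b * c); rewrite scalerA.
(* As y is outside J, the ideal J + A y exceeds J and must contain x0; the coefficient of y then
   cannot kill I, so it can be inverted. *)
have [u [_ [Ju [a ->] e]]] : addm J Ay x0.
  apply: contrapT => n0; apply: nJy.
  apply: (maxJ (addm J Ay)) => //; first exact: opsub_addm.
  - by apply: addml; apply: opsub0 sAy.
  - by apply: (addm_sub sI) => // _ [a ->]; apply: (opsubZ sI).
  - by apply: (addmr (opsub0 sJ)); exists 1; rewrite scale1r.
have [aI|/inv [b hb]] := dich a; first by case: nJ; rewrite e aI // addr0.
rewrite (hb y) //; apply: (opsubZ sC) => //.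
by apply: (opsub_addr (y := u) sC); [apply: JC|rewrite addrC -e].
Qed.

Lemma artinian_acc : @acc A A^o setT setT.
Proof.
have [n cn] := artinian_length.
by apply: (@bounded_acc _ _ _ _ n (opsub_setT _ _)) => k; apply: comp_series_bound cn.
Qed.
End Artinian.

(** * Finitely generated modules over finitely generated algebras *)

Section NoetherianModules.
Variables (A : comNzRingType) (B : comAlgType A) (M : lmodType B).
Hypothesis accA : @acc A A^o setT setT.
Implicit Types (N W : set M) (gs : seq B) (vs : seq M).

Definition scalars : set B := [set b | exists a : A, b = a%:A].

(** Only the scalars and the listed generators act, so that algebra generators can be added one at a
    time. *)
Definition ops gs : set B := scalars `|` [set b | b \in gs].

Definition ospan (O : set B) vs : set M :=
  [set x | forall N, opsub O N -> (forall v, v \in vs -> N v) -> N x].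

Lemma opsub_ospan O vs : opsub O (ospan O vs).
Proof.
split; first by move=> N sN _; apply: opsub0 sN.
- by move=> x y hx hy N sN h; apply: (opsubB sN); [apply: hx|apply: hy].
- by move=> b x Ob hx N sN h; apply: (opsubZ sN) => //; apply: hx.
Qed.

Lemma opsubW (O O' : set B) N : O `<=` O' -> opsub O' N -> opsub O N.
Proof. by move=> OO [N0 NB NZ]; split=> // b x /OO; apply: NZ. Qed.

Lemma ops0 : ops [::] = scalars.
Proof. by apply/seteqP; split=> b; [case|left]. Qed.

Lemma stableW (T : Type) (N : nat -> set T) k j :
  (forall i, N i `<=` N i.+1) -> (forall i, (k <= i)%N -> N i `<=` N k) ->
  (k <= j)%N -> forall i, N i `<=` N j.
Proof.
move=> NS st kj i; have [ij|ji] := leqP i j; first exact: chain_mono.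
apply: (@subset_trans _ (N k)); last exact: chain_mono.
by apply: st; apply: leq_trans kj (ltnW ji).
Qed.

(** Induction on the generators: an ascending chain is controlled by its intersections with the span
    W of the remaining ones and by the ideals L i of the coefficients of v modulo W. *)
Lemma acc_scalars vs : acc scalars (ospan scalars vs).
Proof.
elim: vs => [|v vs IH] N sN NV NS.
  exists 0%N => i _ x /NV /(_ _ (opsub_set0 _ _)) -> //.
  exact: opsub0 (sN _).
pose W := ospan scalars vs; have sW : opsub scalars W := opsub_ospan _ _.
pose L i : set A^o := [set a | exists2 w, W w & N i (a%:A *: v + w)].
have [|||k1 h1] := accA (N := L).
- move=> i; split; first (exists 0; rewrite ?scale0r ?scale0r ?addr0;
  [exact: opsub0 sW|exact: opsub0 (sN _)]).
  + move=> a b [w Ww Nw] [w' Ww' Nw']; exists (w - w'); first exact: (opsubB sW).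
    rewrite scalerBl scalerBl addrACA -opprD; exact: (opsubB (sN _)).
  + move=> c a _ [w Ww Nw]; exists (c%:A *: w); first by apply: (opsubZ sW) => //;
    exists c.
    have -> : (c *: a : A^o)%:A *: v = c%:A *: (a%:A *: v).
      by rewrite scalerA -scalerAl mul1r scalerA.
    by rewrite -scalerDr; apply: (opsubZ (sN _)) => //; exists c.
- by [].
- by move=> i a [w Ww Nw]; exists w => //; apply: NS.
have [|||k2 h2] := IH (fun i => N i `&` W).
- by move=> i; apply: opsubI.
- by move=> i x [].
- by move=> i x [/NS].
have LS i : L i `<=` L i.+1 by move=> a [w Ww Nw]; exists w => //; apply: NS.
have NWS i : N i `&` W `<=` N i.+1 `&` W by move=> x [/NS].
exists (maxn k1 k2) => i ki n Nn.
have [a [w Ww e]] : exists a : A, exists2 w, W w & n = a%:A *: v + w.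
  apply: (NV _ _ Nn [set n | exists a : A, exists2 w, W w & n = a%:A *: v + w]).
    split; first by exists 0, 0; rewrite ?scale0r ?scale0r ?addr0 //; apply: opsub0 sW.
    - move=> _ _ [a [w Ww ->]] [b [w' Ww' ->]]; exists (a - b), (w - w').
        exact: (opsubB sW).
      by rewrite opprD addrACA scalerBl scalerBl.
    - move=> _ _ [c ->] [a [w Ww ->]]; exists (c * a), (c%:A *: w).
        by apply: (opsubZ sW) => //; exists c.
      by rewrite scalerDr scalerA -scalerAl mul1r scalerA.
  move=> u; rewrite inE => /orP [/eqP ->|uvs].
    by exists 1, 0; rewrite ?addr0 ?scale1r ?scale1r //; apply: opsub0 sW.
  by exists 0, u; rewrite ?scale0r ?scale0r ?add0r // => N' _; apply.
have [w' Ww' Nw'] : L (maxn k1 k2) a.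
  apply: (stableW LS h1 (leq_maxl _ _) (i := i)).
  by exists w; rewrite -?e.
have [h _] : (N (maxn k1 k2) `&` W) (w - w').
  apply: (stableW NWS h2 (leq_maxr _ _) (i := i)); split; last exact: (opsubB sW).
  rewrite -(addrKA (a%:A *: v)) [w + _]addrC -e.
  by apply: (opsubB (sN _)) => //; apply: (chain_mono NS ki).
rewrite e -[w](subrK w') addrCA; exact: (opsubD (sN _)).
Qed.

(* Hilbert's basis theorem: [L j (N i)] consists of the leading coefficients of
   the elements of [N i] that are polynomials of degree [j] in [g]. *)
Lemma acc_cons g gs vs : acc (ops gs) (ospan (ops gs) vs) ->
  acc (ops (g :: gs)) (ospan (ops (g :: gs)) vs).
Proof.
set W := ospan (ops gs) vs => accW N sN' NV NS.
have opsS : ops gs `<=` ops (g :: gs).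
  by move=> b [?|h]; [left|right; rewrite /= inE; apply/orP; right].
have gops : ops (g :: gs) g by right; rewrite /= inE eqxx.
have sW : opsub (ops gs) W := opsub_ospan _ _.
have sN i : opsub (ops gs) (N i) by apply: opsubW opsS (sN' i).
pose X j : set M := [set z | exists2 w, W w & z = g ^+ j *: w].
(* D j consists of the sums of terms g^k w with k < j. As g may satisfy relations, representations
   are not unique, and membership in this filtration replaces the degree. *)
pose D := fix D j : set M := if j is k.+1 then addm (D k) (X k) else [set 0].
have sX j : opsub (ops gs) (X j).
  split; first by exists 0; rewrite ?scaler0 //; apply: opsub0 sW.
  - by move=> _ _ [w Ww ->] [w' Ww' ->]; exists (w - w'); rewrite ?scalerBr //;
    apply: (opsubB sW).
  - move=> b _ Ob [w Ww ->]; exists (b *: w); first exact: (opsubZ sW).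
    by rewrite !scalerA mulrC.
have sD j : opsub (ops gs) (D j).
  by elim: j => [|j IH]; [apply: opsub_set0|apply: opsub_addm].
have DS j : D j `<=` D j.+1 by apply: addml; apply: opsub0 (sX _).
have gD j x : D j x -> D j.+1 (g *: x).
  elim: j x => [|j IH] x; first by move=> ->; rewrite scaler0; apply: opsub0 (sD _).
  move=> [u [_ [Du [w Ww ->] ->]]]; rewrite scalerDr; apply: addmP; first exact: IH.
  by exists w => //; rewrite scalerA -exprS.
have VD x : ospan (ops (g :: gs)) vs x -> exists j, D j x.
  move=> /(_ [set y | exists j, D j y]); apply.
    split; first by exists 0%N.
    - move=> y z [i Dy] [j Dz]; exists (maxn i j); apply: (opsubB (sD _)).
        by apply: (chain_mono DS (leq_maxl _ _)).
      by apply: (chain_mono DS (leq_maxr _ _)).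
    - move=> b y Ob [j Dy]; have [->|bg] := eqVneq b g.
        by exists j.+1; apply: gD.
      exists j; apply: (opsubZ (sD _)) => //.
      by case: Ob => [?|]; [left|rewrite /= inE (negPf bg) => ?; right].
  move=> v hv; exists 1%N; rewrite /= -[v]add0r; apply: addmP => //.
  by exists v; rewrite ?expr0 ?scale1r // => ? _; apply.
pose L j (Y : set M) : set M := [set w | W w /\ exists2 u, D j u & Y (g ^+ j *: w + u)].
have sL j i : opsub (ops gs) (L j (N i)).
  split.
  - split; first exact: opsub0 sW.
    by exists 0; rewrite ?scaler0 ?addr0; [apply: opsub0 (sD _)|apply: opsub0 (sN _)].
  - move=> x y [Wx [u Du Nu]] [Wy [u' Du' Nu']]; split; first exact: (opsubB sW).
    exists (u - u'); first exact: (opsubB (sD _)).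
    by rewrite scalerBr addrACA -opprD; apply: (opsubB (sN _)).
  - move=> b x Ob [Wx [u Du Nu]]; split; first exact: (opsubZ sW).
    exists (b *: u); first exact: (opsubZ (sD _)).
    by rewrite scalerA mulrC -scalerA -scalerDr; apply: (opsubZ (sN _)).
have LN j i : L j (N i) `<=` L j (N i.+1).
  by move=> w [Ww [u Du Nu]]; split=> //; exists u => //; apply: NS.
have LS j i : L j (N i) `<=` L j.+1 (N i).
  move=> w [Ww [u Du Nu]]; split=> //; exists (g *: u); first exact: gD.
  by rewrite exprS -scalerA -scalerDr; apply: (opsubZ (sN' _)).
have Lmono j j' i i' : (j <= j')%N -> (i <= i')%N -> L j (N i) `<=` L j' (N i').
  move=> jj ii; apply: (@subset_trans _ (L j (N i'))).
    exact: (chain_mono (LN j)).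
  by apply: (chain_mono (LS^~ i')).
have LW j i : L j (N i) `<=` W by move=> w [].
(* L j (N i) grows in both indices. The stage k0 where the diagonal stabilizes settles all j >= k0;
   the finitely many smaller j are stabilized one by one, and K serves for all of them. *)
have [|||k0 h0] := accW (fun i => L i (N i)) => //.
  by move=> i; apply: Lmono.
have stab j : exists k, forall i, (k <= i)%N -> L j (N i) `<=` L j (N k).
  by apply: (accW (fun i => L j (N i))); [move=> i; apply: sL|move=> i;
    apply: LW|apply: LN].
have [K [k0K hK]] : exists K, (k0 <= K)%N /\
    forall j, (j < k0)%N -> forall i, L j (N i) `<=` L j (N K).
  suff h n : exists K, (k0 <= K)%N /\
      forall j, (j < n)%N -> forall i, L j (N i) `<=` L j (N K) by exact: (h k0).
  elim: n => [|n [K [kK hK]]]; first by exists k0; split.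
  have [k hk] := stab n; exists (maxn K k).
  split; first by rewrite leq_max kK.
  move=> j; rewrite ltnS leq_eqVlt => /orP [/eqP -> i|/hK h i].
    by apply: (stableW (LN n) hk); rewrite leq_maxr.
  by apply: subset_trans (h i) _; apply: Lmono => //; rewrite leq_maxl.
have LK j i : L j (N i) `<=` L j (N K).
  have [/hK|k0j] := ltnP j k0; first exact.
  apply: (@subset_trans _ (L (maxn i j) (N (maxn i j)))).
    by apply: Lmono; rewrite ?leq_maxl ?leq_maxr.
  apply: subset_trans (h0 _ _) _; first by rewrite leq_max k0j orbT.
  exact: Lmono.
exists K => i Ki n Nn; have [j] := VD _ (NV _ _ Nn).
elim: j n Nn => [|j IH] n Nn; first by move=> ->; apply: opsub0 (sN _).
move=> [u [_ [Du [w Ww ->] e]]].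
have [_ [u' Du' Nu']] : L j (N K) w.
  by apply: (LK j i); split=> //; exists u; rewrite // addrC -e.
have h : N K (u - u').
  apply: IH; last exact: (opsubB (sD _)).
  rewrite -(addrKA (g ^+ j *: w)) -e.
  apply: (opsubB (sN _)) => //; exact: (chain_mono NS Ki).
rewrite e -[u](subrK u') -addrA [u' + _]addrC; exact: (opsubD (sN _)).
Qed.

Lemma acc_fg gs vs : acc (ops gs) (ospan (ops gs) vs).
Proof.
elim: gs => [|g gs IH]; last exact: acc_cons.
by rewrite ops0; apply: acc_scalars.
Qed.

Hypothesis gsB : exists gs : seq B, forall S : {pred B},
  GRing.subalg_closed S -> {subset gs <= S} -> forall b, b \in S.

Lemma noetherian : mod_finitely_generated M -> @acc B M setT setT.
Proof.
move=> [vs hvs]; have [gs hgs] := gsB.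
have sV : opsub setT (ospan (ops gs) vs).
  have [V0 VB VZ] := opsub_ospan (ops gs) vs; split=> // b x _.
  (* The b that preserve the span form a subalgebra containing the generators. *)
  pose S := pred_of [set b : B | forall x, ospan (ops gs) vs x ->
    ospan (ops gs) vs (b *: x)].
  suff /pred_ofP : b \in S by apply.
  apply: hgs.
    split.
    - by apply/pred_ofP => y Vy; rewrite scale1r.
    - move=> a c c' /pred_ofP hc /pred_ofP hc'; apply/pred_ofP => y Vy.
      rewrite scalerDl; apply: (opsubD (opsub_ospan _ _)); last exact: hc'.
      rewrite -[c]mul1r scalerAl -scalerA; apply: VZ; last exact: hc.
      by left; exists a.
    - move=> c c' /pred_ofP hc /pred_ofP hc'; apply/pred_ofP => y Vy.
      by rewrite -scalerA; apply: hc; apply: hc'.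
  by move=> g gg; apply/pred_ofP => y; apply: VZ; right.
have VT : ospan (ops gs) vs = setT.
  apply/seteqP; split=> // x _; apply/pred_ofP/hvs; first exact: opsub_submod.
  by move=> v hv; apply/pred_ofP => N _; apply.
move=> N sN _ NS; apply: (@acc_fg gs vs N _ _ NS) => i; last by rewrite VT.
exact: opsubW (sN i).
Qed.

End NoetherianModules.

(** * Gradings *)

Section Components.
Variables (I : choiceType) (V : zmodType) (G : I -> {pred V}).
Hypothesis dG : direct_sum G.

Lemma comp0 i : 0 \in G i.
Proof. by case: dG => /(_ i) []. Qed.
Lemma compB i x y : x \in G i -> y \in G i -> x - y \in G i.
Proof. by case: dG => /(_ i) [_ h] _ _; apply: h. Qed.
Lemma compN i x : x \in G i -> - x \in G i.
Proof. by move=> h; rewrite -sub0r compB ?comp0. Qed.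
Lemma compD i x y : x \in G i -> y \in G i -> x + y \in G i.
Proof. by move=> hx hy; rewrite -[y]opprK compB ?compN. Qed.
Lemma compMn i x n : x \in G i -> x *+ n \in G i.
Proof. by move=> hx; elim: n => [|n IH]; rewrite ?comp0 // mulrS compD. Qed.

Lemma big_if_mem (s t : seq I) (c : I -> V) : uniq s -> uniq t ->
  {subset s <= t} -> \sum_(i <- t) (if i \in s then c i else 0) = \sum_(i <- s) c i.
Proof.
move=> us ut st; rewrite -big_mkcond -big_filter; apply: perm_big.
apply: uniq_perm => //; first exact: filter_uniq.
by move=> i; rewrite mem_filter; case: (boolP (i \in s)) => // /st.
Qed.

(** [sum_components] allows an index to be repeated, while the independence clause of [direct_sum]
    speaks of duplicate-free lists; repetitions are merged by counting them. *)
Lemma graded_repr v : {sc : seq I * (I -> V) |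
  [/\ uniq sc.1, forall i, sc.2 i \in G i & v = \sum_(i <- sc.1) sc.2 i]}.
Proof.
apply: cid; case: dG => _ /(_ v) /asboolP [s [c [_ hc ->]]] _.
exists (undup s, fun i => c i *+ count_mem i s); split=> /= [|i|].
- exact: undup_uniq.
- exact: compMn.
- exact/esym/big_undup_iterop_count.
Qed.

Definition gsupp v : seq I := (sval (graded_repr v)).1.
Definition gcmp v i : V := if i \in gsupp v then (sval (graded_repr v)).2 i else 0.

Lemma gsupp_uniq v : uniq (gsupp v).
Proof. by rewrite /gsupp; case: (svalP (graded_repr v)). Qed.

Lemma gcmp_mem v i : gcmp v i \in G i.
Proof.
by rewrite /gcmp; case: ifP => _; rewrite ?comp0 //; case: (svalP (graded_repr v)).
Qed.

Lemma gcmp_sum v : v = \sum_(i <- gsupp v) gcmp v i.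
Proof.
case: (svalP (graded_repr v)) => u _ {1}->; rewrite -/(gsupp v).
by rewrite [LHS]big_seq [RHS]big_seq; apply: eq_bigr => i; rewrite /gcmp => ->.
Qed.

Lemma gcmp_out v i : i \notin gsupp v -> gcmp v i = 0.
Proof. by rewrite /gcmp => /negPf ->. Qed.

(** The difference of two decompositions, extended by 0 to a common duplicate-free list, is a
    relation, so directness kills each of its terms. Hence the components do not depend on the
    representation chosen. *)
Lemma gcmp_uniq v s (c : I -> V) : uniq s -> (forall i, c i \in G i) ->
  v = \sum_(i <- s) c i -> forall i, gcmp v i = if i \in s then c i else 0.
Proof.
move=> us hc ev i; set t := undup (s ++ gsupp v).
have ut : uniq t := undup_uniq _.
have st : {subset s <= t} by move=> j hj; rewrite mem_undup mem_cat hj.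
have gt : {subset gsupp v <= t} by move=> j hj; rewrite mem_undup mem_cat hj orbT.
pose D j := (if j \in s then c j else 0) - gcmp v j.
have hD j : D j \in G j.
  by apply: compB; [case: ifP => _; rewrite ?comp0|apply: gcmp_mem].
have D0 : \sum_(j <- t) D j = 0.
  rewrite big_split /= sumrN big_if_mem // -ev.
  rewrite (eq_bigr (fun j => if j \in gsupp v then gcmp v j else 0)); last first.
    by move=> j _; case: ifPn => // /gcmp_out.
  by rewrite big_if_mem ?gsupp_uniq // -gcmp_sum subrr.
case: dG => _ _ /(_ t D ut hD D0) h.
have [it|nit] := boolP (i \in t); first by apply/esym/subr0_eq; apply: h.
rewrite gcmp_out; last by apply: contra nit => /gt.
by rewrite ifN //; apply: contra nit => /st.
Qed.

Lemma gcmpB v w i : gcmp (v - w) i = gcmp v i - gcmp w i.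
Proof.
set t := undup (gsupp v ++ gsupp w).
have e u : {subset gsupp u <= t} -> u = \sum_(j <- t) gcmp u j.
  move=> ut; rewrite {1}[u]gcmp_sum -(big_if_mem _ (gsupp_uniq u) (undup_uniq _) ut).
  by apply: eq_bigr => j _; case: ifPn => // /gcmp_out.
rewrite (gcmp_uniq (s := t) (c := fun j => gcmp v j - gcmp w j)).
- case: ifPn => //; rewrite mem_undup mem_cat negb_or => /andP [nv nw].
  by rewrite !gcmp_out ?subr0.
- exact: undup_uniq.
- by move=> j; apply: compB; apply: gcmp_mem.
- rewrite big_split /= sumrN -!e // => j hj; rewrite mem_undup mem_cat hj ?orbT //.
Qed.

Lemma gcmp0 i : gcmp 0 i = 0.
Proof. by have := gcmpB 0 0 i; rewrite !subrr. Qed.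
Lemma gcmpN v i : gcmp (- v) i = - gcmp v i.
Proof. by rewrite -sub0r gcmpB gcmp0 sub0r. Qed.
Lemma gcmpD v w i : gcmp (v + w) i = gcmp v i + gcmp w i.
Proof. by rewrite -{1}[w]opprK gcmpB gcmpN opprK. Qed.
Lemma gcmp_big (J : Type) (s : seq J) (P : pred J) (F : J -> V) i :
  gcmp (\sum_(j <- s | P j) F j) i = \sum_(j <- s | P j) gcmp (F j) i.
Proof.
by apply: (big_morph (fun v => gcmp v i)) => [v w|]; rewrite ?gcmpD ?gcmp0.
Qed.

Lemma gcmp_hom v i j : v \in G i -> gcmp v j = if j == i then v else 0.
Proof.
move=> vi; rewrite (gcmp_uniq (s := [:: i]) (c := fun k => if k == i then v else 0)).
- by rewrite inE; case: (j == i).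
- by [].
- by move=> k; case: eqP => [->//|_]; rewrite comp0.
- by rewrite big_seq1 eqxx.
Qed.

Lemma gcmp_ext v w : (forall i, gcmp v i = gcmp w i) -> v = w.
Proof.
move=> h; apply/subr0_eq; rewrite [v - w]gcmp_sum big1 // => i _.
by rewrite gcmpB h subrr.
Qed.

Lemma graded_ind (K : V -> Prop) : (forall i v, v \in G i -> K v) -> K 0 ->
  (forall v w, K v -> K w -> K (v + w)) -> forall v, K v.
Proof.
move=> Kh K0 KD v; rewrite [v]gcmp_sum; elim/big_ind: _ => // i _.
exact/Kh/gcmp_mem.
Qed.

Definition proj (P : pred I) v : V := \sum_(i <- gsupp v | P i) gcmp v i.

Lemma gcmp_proj P v i : gcmp (proj P v) i = if P i then gcmp v i else 0.
Proof.
rewrite (gcmp_uniq (s := [seq j <- gsupp v | P j]) (c := gcmp v)).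
- rewrite mem_filter; case: (P i) => //=.
  by case: ifPn => // /gcmp_out ->.
- exact/filter_uniq/gsupp_uniq.
- exact: gcmp_mem.
- by rewrite big_filter.
Qed.

Lemma projB P v w : proj P (v - w) = proj P v - proj P w.
Proof.
by apply: gcmp_ext => i; rewrite gcmpB !gcmp_proj gcmpB; case: ifP; rewrite ?subr0.
Qed.

Lemma projD P v w : proj P (v + w) = proj P v + proj P w.
Proof.
by apply: gcmp_ext => i; rewrite gcmpD !gcmp_proj gcmpD; case: ifP; rewrite ?addr0.
Qed.

Lemma proj0 P : proj P 0 = 0.
Proof. by apply: gcmp_ext => i; rewrite gcmp_proj gcmp0; case: ifP. Qed.

Lemma proj_hom P v i : v \in G i -> proj P v = if P i then v else 0.
Proof.
move=> vi; apply: gcmp_ext => j; rewrite gcmp_proj (gcmp_hom _ vi).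
have [->|ne] := eqVneq j i; first by case: ifP => _;
  rewrite ?gcmp0 // (gcmp_hom _ vi) eqxx.
by case: ifP => _; case: ifP => _; rewrite ?gcmp0 // (gcmp_hom _ vi) (negPf ne).
Qed.

Lemma sum_componentsP (P : pred I) v : v \in sum_components G P <-> proj P v = v.
Proof.
split.
  move=> /asboolP [s [c [/allP sP hc ->]]]; rewrite big_seq.
  elim/big_ind: _ => [|x y hx hy|i /sP Pi]; first exact: proj0.
    by rewrite projD hx hy.
  by rewrite (proj_hom _ (hc i)) Pi.
move=> <-; apply/asboolP; exists [seq i <- gsupp v | P i], (gcmp v); split.
- exact: filter_all.
- exact: gcmp_mem.
- by rewrite big_filter.
Qed.

Lemma proj_comp (P Q : pred I) v : proj P (proj Q v) = proj (fun i => P i && Q i) v.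
Proof.
by apply: gcmp_ext => i; rewrite !gcmp_proj; case: (P i) => //=; case: (Q i).
Qed.

Lemma eq_proj (P Q : pred I) v : P =1 Q -> proj P v = proj Q v.
Proof. by move=> PQ; apply: gcmp_ext => i; rewrite !gcmp_proj PQ. Qed.

End Components.

(** * Prime ideals *)

Section PrimeSets.
Variable B : comNzRingType.
Implicit Types p q : set B.

Definition is_prime p : Prop :=
  [/\ @opsub B B^o setT p, ~ p 1 & forall x y, p (x * y) -> p x \/ p y].

Lemma is_prime_of (P : prime_idealr B) : is_prime [set x | x \in P].
Proof.
split.
- split; first exact: idealr0.
  + by move=> x y /= hx hy; apply: rpredB.
  + by move=> b x _ /= hx; apply: idealMr.
- by rewrite /= idealr1.
- by move=> x y /=; rewrite prime_idealrM => /orP.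
Qed.

Lemma prime_of p : is_prime p -> {P : prime_idealr B | (P : {pred B}) = pred_of p}.
Proof.
move=> [sp p1 pM].
have h1 : idealr_closed (pred_of p).
  split; first exact/pred_ofP/(opsub0 sp).
    by apply/negP => /pred_ofP.
  move=> a u v /pred_ofP pu /pred_ofP pv; apply/pred_ofP.
  by apply: (opsubD sp) => //; apply: (opsubZ (b := a) sp).
have h2 : prime_idealr_closed (pred_of p).
  move=> u v /pred_ofP /pM [h|h]; apply/orP; [left|right]; exact/pred_ofP.
by exists (HB.pack_for (prime_idealr B) (pred_of p)
  (isIdealr.Build B (pred_of p) h1) (isPrimeIdealrClosed.Build B (pred_of p) h2)).
Qed.

Lemma prime_sub p : is_prime p -> @opsub B B^o setT p. Proof. by case. Qed.

Lemma prime_mull p a b : is_prime p -> p b -> p (a * b).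
Proof. by case=> sp _ _; apply: (opsubZ (b := a) sp). Qed.

(** Anchored at its bottom p: the lengths of these chains compute dim B/p, and a prime strictly
    below p prolongs a chain by one. *)
Inductive prime_chain : set B -> nat -> Prop :=
| prime_chain0 p : is_prime p -> prime_chain p 0
| prime_chainS p q k : is_prime p -> p `<=` q -> ~ (q `<=` p) -> prime_chain q k ->
  prime_chain p k.+1.

Lemma prime_chain_prime p k : prime_chain p k -> is_prime p.
Proof. by case. Qed.

Lemma prime_chain_fun p k : prime_chain p k -> exists c : nat -> set B,
  [/\ c 0%N = p, forall i, (i <= k)%N -> is_prime (c i),
      forall i, (i <= k)%N -> p `<=` c i &
      forall i, (i < k)%N -> c i `<=` c i.+1 /\ ~ (c i.+1 `<=` c i)].
Proof.
elim=> [q hq|q q' n hq qq' nq'q _ [c [c0 c1 c2 c3]]].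
  by exists (fun=> q); split=> // i _; apply: subset_refl.
exists (fun i => if i is j.+1 then c j else q); split=> //.
- by case=> // i; apply: c1.
- by case=> [_|i ik]; [apply: subset_refl|apply: subset_trans qq' (c2 _ _)].
- by case=> [_|i]; [rewrite c0|apply: c3].
Qed.

Lemma fun_prime_chain (c : nat -> set B) k : (forall i, (i <= k)%N -> is_prime (c i)) ->
  (forall i, (i < k)%N -> c i `<=` c i.+1 /\ ~ (c i.+1 `<=` c i)) ->
    prime_chain (c 0%N) k.
Proof.
elim: k c => [|k IH] c c1 c2; first exact/prime_chain0/c1.
have [h h'] := c2 0%N isT.
by apply: (prime_chainS (c1 0%N isT) h h'); apply: (IH (c \o succn)) => i ik;
  [apply: c1|apply: c2].
Qed.

End PrimeSets.

(** * Primality tested on homogeneous elements *)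

Section LexMax.
Variable r : nat.
Implicit Types a b c : Ngr r.

Definition lexlt a b : Prop :=
  exists k : 'I_r, (forall j : 'I_r, (j < k)%N -> a j = b j) /\ (a k < b k)%N.

Lemma lexlt_irr a : ~ lexlt a a.
Proof. by case=> k [_]; rewrite ltnn. Qed.

Lemma lexlt_trans a b c : lexlt a b -> lexlt b c -> lexlt a c.
Proof.
move=> [k [ek lk]] [l [el ll]]; have [kl|lk'|/val_inj kl] := ltngtP k l.
- exists k; split; last by rewrite -el.
  by move=> j jk; rewrite ek // el //; apply: ltn_trans kl.
- exists l; split; last by rewrite ek.
  by move=> j jl; rewrite ek ?el //; apply: ltn_trans lk'.
- subst l; exists k; split; last exact: ltn_trans ll.
  by move=> j jk; rewrite ek ?el.
Qed.

Lemma lexlt_total a b : a <> b -> lexlt a b \/ lexlt b a.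
Proof.
move=> ne; have [k0 nk0] : exists k, a k != b k.
  apply: contrapT => h; apply: ne; apply/ffunP => i; apply/eqP.
  by apply: contrapT => /negP hi; apply: h; exists i.
case: (@arg_minnP _ k0 (fun k => a k != b k) (fun k => k : nat) nk0) => k nk mk.
have ek (j : 'I_r) : (j < k)%N -> a j = b j.
  by move=> jk; apply/eqP; apply: contraLR jk => /mk; rewrite -leqNgt.
have [lt|gt|e] := ltngtP (a k) (b k); [left|right|by rewrite e eqxx in nk].
  by exists k.
by exists k; split=> // j /ek.
Qed.

Lemma lexlt_add a b a' b' : Nadd a' b' = Nadd a b -> (a', b') <> (a, b) ->
  lexlt a a' \/ lexlt b b'.
Proof.
move=> e ne.
have ei i : (a' i + b' i = a i + b i)%N by move/ffunP/(_ i): e; rewrite !ffunE.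
have [aa|na] := pselect (a' = a).
  case: ne; rewrite aa; congr (_, _); apply/ffunP => i.
  by have := ei i; rewrite aa => /addnI.
have [[k [ek lk]]|] := lexlt_total na; last by left.
right; exists k; split.
  by move=> j jk; have := ei j; rewrite ek // => /addnI.
by have := ei k; move: lk; lia.
Qed.

Lemma lex_max (s : seq (Ngr r)) : s != [::] ->
  exists2 a, a \in s & forall b, b \in s -> ~ lexlt a b.
Proof.
elim: s => // a [|a' s] IH _.
  by exists a; rewrite ?mem_head // => b; rewrite inE => /eqP ->; apply: lexlt_irr.
have [//|c c_s hc] := IH.
have [ca|nca] := pselect (lexlt c a).
  exists a; rewrite ?mem_head // => b; rewrite inE => /orP [/eqP ->|/hc h ab].
    exact: lexlt_irr.
  by apply/h/lexlt_trans/ab.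
exists c; first by rewrite inE c_s orbT.
by move=> b; rewrite inE => /orP [/eqP ->|/hc].
Qed.

End LexMax.

Section HomogeneousPrime.
Variables (r : nat) (A : comNzRingType) (B : comAlgType A).
Variable Bgr : Ngr r -> {pred B}.
Hypothesis grB : graded_ring Bgr.

Lemma grB_direct : direct_sum Bgr. Proof. by case: grB. Qed.
Local Notation dB := grB_direct.

Lemma grB_mul m n x y : x \in Bgr m -> y \in Bgr n -> x * y \in Bgr (Nadd m n).
Proof. by case: grB => _ _; apply. Qed.

(** If f and g were both outside q, take their lexicographically last components f_a and g_b outside
    q. By [lexlt_add], every other product contributing to degree a + b has a factor in a later
    degree, hence in q; so f_a g_b lies in q because the component of f g does. *)
Lemma homogeneous_prime (q : set B) : @opsub B B^o setT q -> ~ q 1 ->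
  (forall f a, q f -> q (gcmp dB f a)) ->
  (forall f g a b, f \in Bgr a -> g \in Bgr b -> q (f * g) -> q f \/ q g) ->
  is_prime q.
Proof.
move=> sq q1 hq qh; split=> // f g qfg; apply: contrapT => /not_orP [nf ng].
have lead h : ~ q h -> exists2 a, ~ q (gcmp dB h a) &
    forall b, ~ q (gcmp dB h b) -> ~ lexlt a b.
  move=> nh; pose s := [seq a <- gsupp dB h | gcmp dB h a \notin pred_of q].
  have hs b : ~ q (gcmp dB h b) -> b \in s.
    move=> nb; rewrite mem_filter; apply/andP; split; first by apply/negP => /pred_ofP.
    apply: contrapT => /negP /gcmp_out e; apply: nb; rewrite e; exact: opsub0 sq.
  have [|a] := @lex_max _ s.
    apply: contra_notN nh => /eqP s0; rewrite (gcmp_sum dB h).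
    apply: (opsub_sum (M := B^o) _ sq) => a _; apply: contrapT => /hs.
    by rewrite s0.
  rewrite mem_filter => /andP [/negP na _] amax; exists a; first by move/pred_ofP.
  by move=> b /hs /amax.
have [a na amax] := lead f nf; have [b nb bmax] := lead g ng.
pose F a' b' := if Nadd a b == Nadd a' b' then gcmp dB f a' * gcmp dB g b' else 0.
have eF : gcmp dB (f * g) (Nadd a b) = \sum_(a' <- gsupp dB f) \sum_(b' <- gsupp dB g)
  F a' b'.
  rewrite {1}(gcmp_sum dB f) {1}(gcmp_sum dB g) mulr_suml gcmp_big.
  apply: eq_bigr => a' _; rewrite mulr_sumr gcmp_big; apply: eq_bigr => b' _.
  by rewrite (gcmp_hom dB _ (grB_mul (gcmp_mem _ _ _) (gcmp_mem _ _ _))).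
pose lt := gcmp dB f a * gcmp dB g b.
have inS h c : ~ q (gcmp dB h c) -> c \in gsupp dB h.
  move=> nc; apply: contrapT => /negP /gcmp_out e; apply: nc; rewrite e;
    exact: opsub0 sq.
have elt : lt = \sum_(a' <- gsupp dB f) \sum_(b' <- gsupp dB g)
    (if (a' == a) && (b' == b) then lt else 0).
  rewrite (bigD1_seq a) ?gsupp_uniq ?inS //= [X in _ = _ + X]big1 => [|a' /negPf ne];
    last first.
    by rewrite big1 // => b' _; rewrite ne.
  rewrite addr0 (bigD1_seq b) ?gsupp_uniq ?inS //= !eqxx big1 ?addr0 // => b' /negPf ne.
  by rewrite ne.
suff : q lt by move=> /(qh _ _ _ _ (gcmp_mem _ _ _) (gcmp_mem _ _ _)) [].
have qF : q (\sum_(a' <- gsupp dB f) \sum_(b' <- gsupp dB g)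
    (F a' b' - if (a' == a) && (b' == b) then lt else 0)).
  apply: (opsub_sum (M := B^o) _ sq) => a' _; apply: (opsub_sum (M := B^o) _ sq) =>
    b' _.
  rewrite /F; have [/andP [/eqP -> /eqP ->]|ne] := boolP ((a' == a) && (b' == b)).
    by rewrite eqxx subrr; apply: opsub0 sq.
  rewrite subr0; case: eqP => [e|_]; last exact: opsub0 sq.
  have [||/= h|/= h] := @lexlt_add r a b a' b'; first by [].
  - by case=> e1 e2; rewrite e1 e2 !eqxx in ne.
  - rewrite mulrC; apply: (opsubZ (b := gcmp dB g b') sq) => //.
    by apply: contrapT => /amax.
  - apply: (opsubZ (b := gcmp dB f a') sq) => //.
    by apply: contrapT => /bmax.
have : q (gcmp dB (f * g) (Nadd a b) - lt).
  rewrite eF {1}elt -sumrB; under eq_bigr do rewrite -sumrB; exact: qF.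
move=> h; rewrite -(subKr (gcmp dB (f * g) (Nadd a b)) lt).
by apply: (opsubB sq) => //; apply: hq.
Qed.

End HomogeneousPrime.

(** * Formal sums of rational functions *)

Lemma inv_coef_neg n (k : int) : k < 0 -> inv_coef n k = 0%N.
Proof. by case: k. Qed.

(** Pascal's rule, that is, (1 - t) / (1 - t)^(n+1) = 1 / (1 - t)^n read on coefficients. *)
Lemma inv_coefS n (k : int) :
  inv_coef n.+1 k = (inv_coef n.+1 (k - 1) + inv_coef n k)%N.
Proof.
case: k => [[|j]|j] //; first by rewrite /= !bin0.
rewrite (_ : j.+1%:Z - 1 = j%:Z) /=; last by lia.
by rewrite !addnS /= binS addnC.
Qed.

Lemma inv_coef0 (k : int) : inv_coef 0 k = (k == 0).
Proof.
by case: k => [[|j]|j] //=; rewrite addn0 bin_small.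
Qed.

Lemma inv_coef1 (k : int) : inv_coef 1 k = (0 <= k).
Proof. by case: k => [j|j] //=; rewrite addn1 binn. Qed.

Lemma inv_coef_homo n (k l : int) : k <= l -> (inv_coef n.+1 k <= inv_coef n.+1 l)%N.
Proof.
move=> kl; have [m ->] : exists m : nat, l = k + m%:Z by exists (absz (l - k)); lia.
elim: m => [|m IH]; first by rewrite addr0.
apply: leq_trans IH _; rewrite (inv_coefS n (k + m.+1%:Z)).
by rewrite (_ : k + m.+1%:Z - 1 = k + m%:Z) ?leq_addr //; lia.
Qed.

(* Coefficient of [t ^ j] in [(1 - t) ^ (n - 1)]. *)
Fixpoint pow_coef (n j : nat) : int :=
  if n is n'.+1 then pow_coef n' j - (if j is j'.+1 then pow_coef n' j' else 0)
  else 1.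

Lemma pow_coef_out n j : (n < j)%N -> pow_coef n.+1 j = 0.
Proof.
elim: n j => [|n IH] [|j] //.
move=> nj; rewrite -[LHS]/(pow_coef n.+1 j.+1 - pow_coef n.+1 j).
by rewrite !IH ?subr0 // ltnW.
Qed.

(** For k < J, the coefficient of t^k in (1 - t)^(n-1) / (1 - t)^n'; the truncation at J keeps the
    sum finite also for n = 0. *)
Definition conv n n' (k : int) J : int :=
  \sum_(j < J) pow_coef n j * (inv_coef n' (k - j%:Z))%:Z.

Lemma convSS n n' (k : int) J : k < J.+1%:Z ->
  conv n.+1 n'.+1 k J.+1 = conv n n' k J.+1.
Proof.
move=> kJ; suff h j : conv n.+1 n'.+1 k j.+1 =
    conv n n' k j.+1 + pow_coef n j * (inv_coef n'.+1 (k - j.+1%:Z))%:Z.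
  by rewrite h inv_coef_neg ?mulr0 ?addr0 //; lia.
have cS a b i : conv a b k i.+1 = conv a b k i + pow_coef a i * (inv_coef b (k -
  i%:Z))%:Z.
  by rewrite /conv big_ord_recr.
elim: j => [|j IH]; rewrite cS.
  rewrite [in RHS]cS /conv !big_ord0 !add0r !subr0 inv_coefS PoszD.
  by rewrite /= subr0 mulrDr addrC.
rewrite IH [in RHS]cS (inv_coefS n' (k - j.+1%:Z)).
rewrite (_ : k - j.+1%:Z - 1 = k - j.+2%:Z); last by lia.
rewrite [pow_coef n.+1 j.+1]/= PoszD !mulrBl !mulrDr.
lia.
Qed.

Lemma conv0 n (k : int) J : 0 <= k -> k < J%:Z -> conv n 0 k J = pow_coef n (absz k).
Proof.
move=> k0 kJ; have hk : (absz k < J)%N by lia.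
rewrite /conv (bigD1 (Ordinal hk)) //= inv_coef0 big1 => [|j ne].
  by rewrite gez0_abs // subrr addr0 mulr1.
rewrite inv_coef0; case: eqP => [e|_]; last by rewrite mulr0.
by case/eqP: ne; apply/val_inj => /=; lia.
Qed.

(** For n' < n the quotient is a polynomial of degree n - n' - 1, which is below k; for n' = n it is
    the geometric series. *)
Lemma convE n n' (k : int) J : (n' <= n)%N -> n%:Z <= k -> k < J%:Z ->
  conv n n' k J = (n' == n)%:Z.
Proof.
elim: n' n J => [|n' IH] [|n] J // nn nk kJ.
- by rewrite conv0.
- by rewrite conv0 ?pow_coef_out //; lia.
case: J kJ => [|J] kJ; first by lia.
by rewrite convSS // IH //; lia.
Qed.

Section FormalDecompositions.
Variable r : nat.
Local Notation term := ((int * Zgr r) * Ngr r)%type.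
Implicit Types (L : seq term) (m : Zgr r) (n : Ngr r) (j : 'I_r).

Definition toZ n : Zgr r := [ffun i => (n i)%:Z].
Definition Zstd j : Zgr r := toZ (Nstd j).
Definition degN n : nat := \sum_(i < r) n i.
Definition degZ m : int := \sum_(i < r) m i.

Lemma degZD m m' : degZ (m + m') = degZ m + degZ m'.
Proof. by rewrite /degZ -big_split; apply: eq_bigr => i _; rewrite ffunE. Qed.
Lemma degZN m : degZ (- m) = - degZ m.
Proof. by rewrite /degZ -sumrN; apply: eq_bigr => i _; rewrite ffunE. Qed.
Lemma degZ_toZ n : degZ (toZ n) = (degN n)%:Z.
Proof.
rewrite /degZ /degN -natz natr_sum; apply: eq_bigr => i _.
by rewrite ffunE natz. Qed.
Lemma degN_add n n' : degN (Nadd n n') = (degN n + degN n')%N.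
Proof. by rewrite /degN -big_split; apply: eq_bigr => i _; rewrite ffunE. Qed.
Lemma degN_std j : degN (Nstd j) = 1%N.
Proof.
rewrite /degN (bigD1 j) //= ffunE eqxx big1 // => i /negPf ne.
by rewrite ffunE ne.
Qed.
Lemma degZ_std j : degZ (Zstd j) = 1.
Proof. by rewrite degZ_toZ degN_std. Qed.

(* The list of the [((c, m), n)] stands for the sum of the [c t^m / (1-t)^n]. *)
Definition weight L n : int := \sum_(t <- L | t.2 == n) t.1.1.
Definition sum_weight L : int := \sum_(t <- L) t.1.1.
Definition of_degree (d : nat) L : Prop := forall t, t \in L -> degN t.2 = d.

Lemma weight_cat L L' n : weight (L ++ L') n = weight L n + weight L' n.
Proof. by rewrite /weight big_cat. Qed.

Lemma sum_weight_by L (S : seq (Ngr r)) : uniq S -> (forall t, t \in L -> t.2 \in S) ->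
  \sum_(n <- S) weight L n = sum_weight L.
Proof.
move=> uS hS; rewrite /sum_weight /weight (exchange_big_dep xpredT) //= big_seq
  [RHS]big_seq.
apply: eq_bigr => t /hS tS; rewrite -big_filter.
rewrite (_ : [seq i <- S | t.2 == i] = [:: t.2]) ?big_seq1 //.
rewrite (eq_filter (a2 := pred1 t.2)); last by move=> x; rewrite /= eq_sym.
exact: filter_pred1_uniq.
Qed.

Lemma weight_out d L n : of_degree d L -> degN n <> d -> weight L n = 0.
Proof.
move=> hL nd; rewrite /weight big_seq_cond big1 // => t /andP [/hL h /eqP e].
by rewrite e in h.
Qed.

Definition shiftL j L : seq term := [seq (t.1, Nadd t.2 (Nstd j)) | t <- L].
(* Multiplication of numerators and denominators by [1 - t_j]. *)
Definition boostL j L : seq term :=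
  shiftL j (L ++ [seq ((- t.1.1, t.1.2 + Zstd j), t.2) | t <- L]).

Lemma of_degree_shift d j L : of_degree d L -> of_degree d.+1 (shiftL j L).
Proof.
by move=> hL _ /mapP [t /hL h ->]; rewrite /= degN_add h degN_std addn1.
Qed.

Lemma of_degree_cat d L L' : of_degree d L -> of_degree d L' -> of_degree d (L ++ L').
Proof. by move=> h h' t; rewrite mem_cat => /orP [/h|/h']. Qed.

Lemma of_degree_boost d j L : of_degree d L -> of_degree d.+1 (boostL j L).
Proof.
move=> hL; apply/of_degree_shift/of_degree_cat => // _ /mapP [t /hL h ->] //.
Qed.

Lemma weight_shift0 j L n : n j = 0%N -> weight (shiftL j L) n = 0.
Proof.
move=> nj; rewrite /weight big_map big1 // => t /eqP e.
by move/ffunP/(_ j): e; rewrite !ffunE eqxx nj addn1.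
Qed.

Lemma weight_shift j L n n' : n = Nadd n' (Nstd j) ->
  weight (shiftL j L) n = weight L n'.
Proof.
move=> ->; rewrite /weight big_map; apply: eq_bigl => t /=.
apply/eqP/eqP => [e|-> //]; apply/ffunP => i.
by move/ffunP/(_ i): e; rewrite !ffunE => /addIn.
Qed.

Lemma Nadd_std j n : (0 < n j)%N -> exists n', n = Nadd n' (Nstd j).
Proof.
move=> nj; exists [ffun i => (n i - Nstd j i)%N]; apply/ffunP => i.
rewrite !ffunE; have [->|_] := eqVneq i j; first by rewrite subn1 addn1 prednK.
by rewrite subn0 addn0.
Qed.

Lemma weight_boost j L n : weight (boostL j L) n = 0.
Proof.
have [nj|nj] := posnP (n j); first exact: weight_shift0.
have [n' e] := Nadd_std nj; rewrite (weight_shift _ e) weight_cat {2}/weight big_map /=.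
by rewrite sumrN subrr.
Qed.

(* The components of degrees satisfying [wP g], over a family of regions indexed
   by [g] and compatible with translations; their lengths are computed by [wc]. *)
Record window := Window {
  wT : Type;
  wsh : 'I_r -> wT -> wT;
  wP : wT -> pred (Zgr r);
  wht : wT -> int;
  wc : Zgr r -> Ngr r -> wT -> nat;
  wP_sh : forall j g m, wP g (m + Zstd j) = wP (wsh j g) m;
  wht_sh : forall j g, wht (wsh j g) = wht g - 1;
  wP_ht : forall g m, wP g m -> degZ m <= wht g;
  wc0 : forall m g, wc m [ffun=> 0%N] g = wP g m;
  wcS : forall j m n g, wc m (Nadd n (Nstd j)) g =
    (wc m (Nadd n (Nstd j)) (wsh j g) + wc m n g)%N;
  wc_sh : forall j m n g, wc (m + Zstd j) n g = wc m n (wsh j g);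
  wc_ht : forall m n g, wht g < degZ m -> wc m n g = 0%N }.

Definition hilb_eval (W : window) L (g : wT W) : int :=
  \sum_(t <- L) t.1.1 * (wc t.1.2 t.2 g)%:Z.

Section Heval.
Variable W : window.
Implicit Type g : wT W.

Lemma hilb_eval_cat L L' g : hilb_eval (L ++ L') g = hilb_eval L g + hilb_eval L' g.
Proof. by rewrite /hilb_eval big_cat. Qed.

(** Expresses on windows that 1 - t_j times the shifted sum is L. *)
Lemma hilb_eval_shift j L g :
  hilb_eval (shiftL j L) g = hilb_eval (shiftL j L) (wsh j g) + hilb_eval L g.
Proof.
rewrite /hilb_eval !big_map -big_split; apply: eq_bigr => t _ /=.
by rewrite wcS PoszD mulrDr.
Qed.

Lemma hilb_eval_boost j L g : hilb_eval (boostL j L) g = hilb_eval L g.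
Proof.
rewrite /hilb_eval big_map big_cat /= big_map -big_split; apply: eq_bigr => t _ /=.
by rewrite wc_sh wcS PoszD mulrDr mulNr addrAC subrr add0r.
Qed.

Lemma hilb_eval_low L : exists b : int, forall g, wht g < b -> hilb_eval L g = 0.
Proof.
elim: L => [|t L [b hb]]; first by exists 0 => g _; rewrite /hilb_eval big_nil.
exists (Num.min b (degZ t.1.2)) => g; rewrite lt_min => /andP [/hb h1 h2].
by rewrite /hilb_eval big_cons -/(hilb_eval _ _) h1 wc_ht // mulr0 addr0.
Qed.

End Heval.
Arguments hilb_eval : clear implicits.

Lemma id_window_S j m n (g : Zgr r) :
  (\prod_(i < r) inv_coef (Nadd n (Nstd j) i) (g i - m i) =
   \prod_(i < r) inv_coef (Nadd n (Nstd j) i) ((g - Zstd j) i - m i)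
   + \prod_(i < r) inv_coef (n i) (g i - m i))%N.
Proof.
rewrite (bigD1 j) //= [X in _ = (X + _)%N](bigD1 j) //=.
rewrite [X in _ = (_ + X)%N](bigD1 j) //= !ffunE eqxx addn1 inv_coefS mulnDl.
congr (_ * _ + _ * _)%N.
- by rewrite addrAC.
- by apply: eq_bigr => i /negPf ne; rewrite !ffunE ne addn0 subr0.
- by apply: eq_bigr => i /negPf ne; rewrite !ffunE ne addn0.
Qed.

Definition id_window : window.
Proof.
refine (@Window (Zgr r) (fun j g => g - Zstd j) (fun g m => m == g) degZ
  (fun m n g => \prod_(i < r) inv_coef (n i) (g i - m i))%N _ _ _ _ _ _ _).
- by move=> j g m; rewrite -(inj_eq (addIr (- Zstd j))) addrK.
- by move=> j g; rewrite degZD degZN degZ_std.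
- by move=> g m /eqP ->.
- move=> m g; have [->|ne] := eqVneq m g.
    by rewrite big1 // => i _; rewrite !ffunE subrr.
  have [i hi] : exists i, m i <> g i.
    apply: contrapT => h; case/eqP: ne; apply/ffunP => i.
    by apply: contrapT => hi; apply: h; exists i.
  rewrite (bigD1 i) //= ffunE inv_coef0 subr_eq0.
  by case: eqP => // e; case: hi.
- exact: id_window_S.
- move=> j m n g; apply: eq_bigr => i _; congr inv_coef.
  by rewrite !ffunE opprD addrA addrAC.
- move=> m n g lt; have [i hi] : exists i, g i < m i.
    apply: contrapT => h; move: lt; rewrite ltNge => /negP; apply.
    apply: ler_sum => i _; rewrite leNgt; apply/negP => hi; apply: h.
    by exists i.
  by rewrite (bigD1 i) //= inv_coef_neg // subr_lt0.
Defined.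

Definition total_window : window.
Proof.
refine (@Window int (fun _ g => g - 1) (fun g m => degZ m == g) id
  (fun m n g => inv_coef (degN n) (g - degZ m)) _ _ _ _ _ _ _).
- by move=> j g m; rewrite degZD degZ_std; apply/eqP/eqP; lia.
- by [].
- by move=> g m /eqP ->.
- move=> m g; rewrite (_ : degN _ = 0%N); last by rewrite /degN big1 // => i;
  rewrite ffunE.
  by rewrite inv_coef0 subr_eq0 eq_sym.
- move=> j m n g; rewrite degN_add degN_std addn1 inv_coefS.
  by congr (inv_coef _ _ + _)%N; lia.
- by move=> j m n g; congr inv_coef; rewrite degZD degZ_std; lia.
- by move=> m n g h; rewrite inv_coef_neg // subr_lt0.
Defined.

(** Summing over all total degrees up to g divides the series by 1 - t, hence the extra one in the
    exponent. *)
Definition cumulative_window : window.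
Proof.
refine (@Window int (fun _ g => g - 1) (fun g m => degZ m <= g) id
  (fun m n g => inv_coef (degN n).+1 (g - degZ m)) _ _ _ _ _ _ _).
- by move=> j g m; rewrite degZD degZ_std; apply/idP/idP; lia.
- by [].
- by [].
- move=> m g; rewrite (_ : degN _ = 0%N); last by rewrite /degN big1 // => i;
  rewrite ffunE.
  by rewrite inv_coef1 subr_ge0.
- move=> j m n g; rewrite degN_add degN_std addn1 inv_coefS.
  by congr (inv_coef _ _ + _)%N; lia.
- by move=> j m n g; congr inv_coef; rewrite degZD degZ_std; lia.
- by move=> m n g h; rewrite inv_coef_neg // subr_lt0.
Defined.

End FormalDecompositions.
Arguments hilb_eval {r} W L g.

(** * Uniqueness of the weights, and growth *)

Section Uniqueness.
Variable r : nat.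
Local Notation term := ((int * Zgr r) * Ngr r)%type.
Implicit Types (L : seq term) (m : Zgr r) (n : Ngr r).

Lemma coord_bound L : exists C : nat,
  forall t, t \in L -> forall i, (`|t.1.2 i| <= C)%N.
Proof.
elim: L => [|t L [C hC]]; first by exists 0%N.
exists (maxn C (\max_i `|t.1.2 i|)%N) => u; rewrite inE => /orP [/eqP ->|uL] i.
  by rewrite leq_max (leq_bigmax (F := fun i => `|t.1.2 i|%N)) orbT.
by rewrite leq_max hC.
Qed.

(* The weight of [n] is recovered by the linear functional extracting the
   coefficient of [t ^ K], for large [K], after multiplication by
   [(1 - t) ^ n / (1 - t)]: it kills the terms with [n' <> n] because
   [n' i < n i] for some [i], all [n'] having the same degree. *)
Lemma weight_eq0 d L : of_degree d L -> (forall nu, hilb_eval (id_window r) L nu = 0) ->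
  forall n, weight L n = 0.
Proof.
move=> hL h0 n; have [nd|] := eqVneq (degN n) d; last by move/eqP; apply: weight_out hL.
(* As |m_i| <= C and n_i <= d, each argument K - m_i lies between d and J - 1, the range where
   [convE] applies. *)
have [C hC] := coord_bound L; pose K : int := (d + C)%:Z; pose J := (d + C + C).+1.
pose G (nu : Zgr r) (t : term) i := inv_coef (t.2 i) (nu i - t.1.2 i).
have hconv t : t \in L ->
    \prod_i conv (n i) (t.2 i) (K - t.1.2 i) J = (t.2 == n)%:Z.
  move=> tL; have nid i : (n i <= d)%N by rewrite -nd /degN (bigD1 i) //= leq_addr.
  have cE i : (t.2 i <= n i)%N ->
      conv (n i) (t.2 i) (K - t.1.2 i) J = (t.2 i == n i)%:Z.
    by move=> le; apply: convE => //; have := hC t tL i; have := nid i; rewrite /K /J;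
      lia.
  have [->|ne] := eqVneq t.2 n; first by rewrite big1 // => i _; rewrite convE ?eqxx //;
    have := hC t tL i; have := nid i; rewrite /K /J; lia.
  have [i hi] : exists i, (t.2 i < n i)%N.
    apply: contrapT => h; case/eqP: ne; apply/ffunP.
    have le i : (n i <= t.2 i)%N by rewrite leqNgt; apply/negP => ?; apply: h; exists i.
    move=> i; apply/eqP; rewrite eqn_leq le andbT.
    have := hL t tL; rewrite -nd /degN (bigD1 i) //= [RHS](bigD1 i) //= => e.
    rewrite -(leq_add2r (\sum_(j < r | j != i) t.2 j)) e leq_add2l.
    by apply: leq_sum.
  by rewrite (bigD1 i) //= (cE i (ltnW hi)) (ltn_eqF hi) mul0r.
(* f records the exponents chosen in the r factors (1 - t_i)^(n_i - 1); the sum over f is the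
   functional applied to the whole series. *)
pose nuf (f : {ffun 'I_r -> 'I_J}) : Zgr r := [ffun i => K - (f i)%:Z].
have : \sum_(f : {ffun 'I_r -> 'I_J}) (\prod_i pow_coef (n i) (f i)) *
   hilb_eval (id_window r) L (nuf f) = 0 by rewrite big1 // => f _; rewrite h0 mulr0.
under eq_bigr do rewrite /hilb_eval mulr_sumr.
rewrite exchange_big /= big_seq => /esym e; rewrite e {e} /weight big_mkcond big_seq.
apply: eq_bigr => t tL.
transitivity (t.1.1 * \prod_i conv (n i) (t.2 i) (K - t.1.2 i) J).
  by rewrite hconv //; case: eqP => _; rewrite ?mulr1 ?mulr0.
rewrite /conv bigA_distr_bigA mulr_sumr; apply: eq_bigr => f _.
rewrite big_split /= mulrCA; congr (_ * (_ * _)).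
rewrite -[RHS]natz natr_prod; apply: eq_bigr => i _.
by rewrite natz ffunE addrAC.
Qed.

Lemma weight_unique d L L' : of_degree d L -> of_degree d L' ->
  (forall nu, hilb_eval (id_window r) L nu = hilb_eval (id_window r) L' nu) ->
  forall n, weight L n = weight L' n.
Proof.
move=> hL hL' e n; pose N : seq term := [seq ((- t.1.1, t.1.2), t.2) | t <- L'].
have wN k : weight N k = - weight L' k by rewrite /weight big_map /= -sumrN.
have hN nu : hilb_eval (id_window r) N nu = - hilb_eval (id_window r) L' nu.
  by rewrite /hilb_eval big_map -sumrN; apply: eq_bigr => t _ /=; rewrite mulNr.
apply/subr0_eq; rewrite -wN -weight_cat; apply: (@weight_eq0 d).
  by apply: of_degree_cat => // _ /mapP [t /hL' h ->].
by move=> nu; rewrite hilb_eval_cat hN e subrr.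
Qed.

(** Telescoping [inv_coefS]: the increment over l steps is controlled by coefficients whose growth
    has one degree less. *)
Lemma inv_coef_diff (n : nat) (x : int) (l : nat) :
  (inv_coef n.+2 (x + l%:Z) <= inv_coef n.+2 x + l * inv_coef n.+1 (x + l%:Z))%N.
Proof.
elim: l => [|l IH]; first by rewrite addr0 mul0n addn0.
rewrite inv_coefS (_ : x + l.+1%:Z - 1 = x + l%:Z); last by lia.
have h : (inv_coef n.+1 (x + l%:Z) <= inv_coef n.+1 (x + l.+1%:Z))%N.
  by apply: inv_coef_homo; lia.
rewrite mulSn [X in (_ <= _ + X)%N]addnC addnA leq_add2r; apply: leq_trans IH _.
by rewrite leq_add2l leq_mul.
Qed.

Lemma ffact_le (n m : nat) : (n ^_ m <= n ^ m)%N.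
Proof.
elim: m n => [|m IH] n //; rewrite ffactnS expnS leq_mul2l.
apply/orP; right; apply: leq_trans (IH _) _.
by case: m {IH} => // m; rewrite leq_exp2r // leq_pred.
Qed.

Lemma ffact_ge K d : (K.+1 ^ d <= (K + d) ^_ d)%N.
Proof.
elim: d => // d IH; rewrite addnS ffactSS expnS leq_mul //.
by rewrite ltnS leq_addr.
Qed.

(* If the leading coefficient [sum_weight L] vanished, the cumulative Hilbert function
   would grow at most like [K ^ (d - 1)]. *)
Lemma sum_weight_neq0 d L (a s : nat) : of_degree d L -> (0 < a)%N ->
  (forall K : nat, ('C(K + d, d))%:Z <=
     hilb_eval (cumulative_window r) L (a * K + s)%N%:Z) ->
  sum_weight L <> 0.
Proof.
move=> hL a0 hK T0.
have [b hb] : exists b : nat, forall t, t \in L -> (`|degZ t.1.2| <= b)%N.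
  exists (\max_(t <- L) `|degZ t.1.2|)%N => t tL.
  exact: (@leq_bigmax_seq _ L xpredT (fun t => `|degZ t.1.2|%N) t tL isT).
have eL g : hilb_eval (cumulative_window r) L g =
    \sum_(t <- L) t.1.1 * (inv_coef d.+1 (g - degZ t.1.2))%:Z.
  rewrite /hilb_eval big_seq [RHS]big_seq; apply: eq_bigr => t /hL td.
  by rewrite /= td.
case: d => [|d] in hL hK eL *.
  (* For d = 0 the cumulative function equals the total weight as soon as the argument reaches b. *)
  have := hK b; rewrite eL addn0 bin0 (_ : \sum_(t <- L) _ = 0) //.
  rewrite -[RHS]T0 /sum_weight big_seq [RHS]big_seq; apply: eq_bigr => t tL.
  rewrite inv_coef1 (_ : 0 <= _) ?mulr1 //; have := hb t tL.
  have : (b <= a * b)%N by rewrite leq_pmull.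
  by move: (degZ _) => x; lia.
pose l (t : term) := absz (b%:Z + degZ t.1.2).
pose S := (\sum_(t <- L) `|t.1.1|%N * l t)%N.
have ub (g : int) : hilb_eval (cumulative_window r) L g <=
    (S * inv_coef d.+1 (g + b%:Z))%N%:Z.
  (* The weights sum to 0, so a common value can be subtracted from all coefficients; each
     difference then spans a distance l t and is bounded by [inv_coef_diff]. *)
  have -> : hilb_eval (cumulative_window r) L g = \sum_(t <- L) t.1.1 *
      ((inv_coef d.+2 (g - degZ t.1.2))%:Z - (inv_coef d.+2 (g + b%:Z))%:Z).
    under [RHS]eq_bigr do rewrite mulrBr.
    by rewrite sumrB -mulr_suml -/(sum_weight L) T0 mul0r subr0.
  rewrite /S big_distrl /= -[leRHS]natz natr_sum big_seq [leRHS]big_seq;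
    apply: ler_sum => t tL.
  have e : g + b%:Z = g - degZ t.1.2 + (l t)%:Z by have := hb t tL; rewrite /l;
    move: (degZ _) => x; lia.
  have h1 : (inv_coef d.+2 (g - degZ t.1.2) <= inv_coef d.+2 (g + b%:Z))%N.
    by rewrite e; apply: inv_coef_homo; rewrite lerDl.
  have := inv_coef_diff d (g - degZ t.1.2) (l t); rewrite -e => h2.
  rewrite natz; apply: le_trans (ler_norm _) _.
  rewrite normrM -mulnA PoszM abszE; apply: ler_wpM2l => //.
  rewrite distrC ger0_norm ?subr_ge0 ?lez_nat //.
  by rewrite lerBlDl -PoszD lez_nat.
(* E gives a K + s + b + d <= E (K + 1), and K = (d+1)! S E^d turns the two growth bounds into
   (K+1)^(d+1) <= K (K+1)^d, which is absurd. *)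
pose E := (a + s + b + d)%N.
have [K eK] : exists K, K = ((d.+1)`! * (S * E ^ d))%N by eexists.
have := le_trans (hK K) (ub _); rewrite lez_nat.
have -> : inv_coef d.+1 ((a * K + s)%N%:Z + b%:Z) = 'C(a * K + s + b + d, d).
  by rewrite -PoszD /= addnS /= -[LHS]bin_sub ?leq_addr // addKn.
move=> h; have h1 : (K.+1 ^ d.+1 <= K * K.+1 ^ d)%N.
  apply: leq_trans (ffact_ge _ _) _; rewrite -bin_ffact.
  apply: (@leq_trans (S * 'C(a * K + s + b + d, d) * (d.+1)`!)).
    by rewrite leq_mul2r h orbT.
  have ac x y z t : (x * (y * z) * t = y * (z * t) * x)%N by lia.
  rewrite [X in (_ <= X * _)%N]eK ac leq_mul2r leq_mul2l.
  apply/orP; right; apply/orP; right; apply: (@leq_trans ((a * K + s + b + d) ^ d)).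
    by apply: leq_trans (ffact_le _ _); rewrite -bin_ffact leq_pmulr ?fact_gt0.
  rewrite -expnMn; have [->|d0] := posnP d; first by rewrite !expn0.
  by rewrite leq_exp2r // /E !mulnDl !mulnS; lia.
by move: h1; rewrite expnS leq_mul2r ltnn orbF expn_eq0.
Qed.

End Uniqueness.

(** Testing against every g yields both the value at 1 and all coefficients of the associated
    series, without comparing supports. *)
Lemma laurent_of (I : choiceType) (s : seq (int * I)) : exists Q : laurent I,
  forall g : I -> int, \sum_(m <- finsupp Q) Q m * g m = \sum_(t <- s) t.1 * g t.2.
Proof.
pose S := seq_fset tt [seq t.2 | t <- s].
have uS : uniq S by apply: fset_uniq.
exists [fsfun m in S => \sum_(t <- s | t.2 == m) t.1 | 0] => g.
set Q := [fsfun _ in _ => _ | _].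
have QE m : Q m = \sum_(t <- s | t.2 == m) t.1.
  rewrite fsfun_fun; case: ifPn => // mS; rewrite big_seq_cond big1 // => t.
  case/andP => ts /eqP e; case/negP: mS.
  by rewrite seq_fsetE; apply/mapP; exists t.
rewrite (_ : \sum_(m <- finsupp Q) _ = \sum_(m <- S) Q m * g m); last first.
  apply: big_fset_incl => [|m _ /fsfun_dflt ->]; last by rewrite mul0r.
  by apply/fsubsetP => m; rewrite mem_finsupp; apply: contraNT => mS;
    rewrite fsfun_fun (negPf mS).
under eq_bigr do rewrite QE mulr_suml.
rewrite (exchange_big_dep xpredT) //= big_seq [RHS]big_seq; apply: eq_bigr => t ts.
rewrite -big_filter (_ : [seq i <- S | t.2 == i] = [:: t.2]) ?big_seq1 //.
rewrite (eq_filter (a2 := pred1 t.2)); last by move=> x; rewrite /= eq_sym.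
by apply: filter_pred1_uniq => //; rewrite seq_fsetE map_f.
Qed.

(** * From formal sums to multiplicities *)

Section HilbertDecompositions.
Variables (r d : nat).
Local Notation term := ((int * Zgr r) * Ngr r)%type.
Implicit Types (L : seq term) (m : Zgr r) (n : Ngr r).

Definition enumN : seq (Ngr r) :=
  [seq n <- [seq [ffun i => f i : nat] | f : {ffun 'I_r -> 'I_d.+1}] | degN n == d].

Lemma enumN_uniq : uniq enumN.
Proof.
apply: filter_uniq; rewrite map_inj_uniq ?enum_uniq // => f g /ffunP e.
by apply/ffunP => i; apply/val_inj; have := e i; rewrite !ffunE.
Qed.

Lemma mem_enumN n : (n \in enumN) = (degN n == d).
Proof.
rewrite mem_filter; case: eqP => //= nd; apply/mapP.
have le i : (n i < d.+1)%N by rewrite ltnS -nd /degN (bigD1 i) //= leq_addr.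
exists [ffun i => Ordinal (le i)]; first by rewrite mem_enum.
by apply/ffunP => i; rewrite !ffunE.
Qed.

Lemma fsbig_Ndegree (F : Ngr r -> int) :
  \sum_(n \in Ndegree r d) F n = \sum_(n <- enumN) F n.
Proof.
have -> : Ndegree r d = [set` enumN].
  by apply/seteqP; split=> n /=; rewrite mem_enumN => /eqP.
by rewrite -fsbig_seq ?enumN_uniq.
Qed.

Definition terms_of (Q : Ngr r -> laurent (Zgr r)) : seq term :=
  flatten [seq [seq ((Q n m, m), n) | m <- finsupp (Q n)] | n <- enumN].

Lemma sum_terms_of Q (P : pred (Ngr r)) (F : term -> int) :
  \sum_(t <- terms_of Q | P t.2) F t =
  \sum_(n <- enumN | P n) \sum_(m <- finsupp (Q n)) F ((Q n m, m), n).
Proof.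
rewrite /terms_of big_flatten big_map [RHS]big_mkcond /=; apply: eq_bigr => n _.
by rewrite big_map /=; case: ifP => Pn; [|rewrite big_pred0].
Qed.

Lemma of_degree_terms Q : of_degree d (terms_of Q).
Proof.
move=> t /flatten_mapP [n]; rewrite mem_enumN => /eqP nd.
by move=> /mapP [m _ ->].
Qed.

Lemma hilb_eval_terms Q nu : hilb_eval (id_window r) (terms_of Q) nu =
  \sum_(n \in Ndegree r d) frac_coef (Q n) n nu.
Proof. by rewrite fsbig_Ndegree /hilb_eval (sum_terms_of Q xpredT). Qed.

Lemma weight_terms Q n : degN n = d -> weight (terms_of Q) n = laurent1 (Q n).
Proof.
move=> nd; rewrite /weight (sum_terms_of Q (pred1 n)) -big_filter.
by rewrite filter_pred1_uniq ?enumN_uniq ?mem_enumN ?nd // big_seq1.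
Qed.

Lemma exists_decomposition H L : of_degree d L -> (forall n, 0 <= weight L n) ->
  (forall nu, (H nu)%:Z = hilb_eval (id_window r) L nu) ->
  exists2 Q, hilb_decomposition H d Q & forall n, laurent1 (Q n) = weight L n.
Proof.
move=> hL wL hH.
have [Q hQ] : {Q : Ngr r -> laurent (Zgr r) & forall n (g : Zgr r -> int),
    \sum_(m <- finsupp (Q n)) Q n m * g m = \sum_(t <- L | t.2 == n) t.1.1 * g t.1.2}.
  apply: (@choice _ _ (fun n (Q : laurent (Zgr r)) => forall g : Zgr r -> int,
    \sum_(m <- finsupp Q) Q m * g m = \sum_(t <- L | t.2 == n) t.1.1 * g t.1.2)) => n.
  have [Q hQ] := laurent_of [seq t.1 | t <- L & t.2 == n].
  by exists Q => g; rewrite hQ big_map big_filter.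
have Q1 n : laurent1 (Q n) = weight L n.
  rewrite /laurent1 /weight; have := hQ n (fun=> 1).
  by under eq_bigr do rewrite mulr1; move=> ->; apply: eq_bigr => t _; rewrite mulr1.
exists Q => //; split=> [n _|nu]; first by rewrite Q1.
rewrite fsbig_Ndegree hH /hilb_eval /frac_coef; under [RHS]eq_bigr do rewrite hQ.
rewrite (exchange_big_dep xpredT) //= big_seq [RHS]big_seq; apply: eq_bigr => t tL.
rewrite -[RHS]big_filter (_ : [seq i <- enumN | t.2 == i] = [:: t.2]) ?big_seq1 //.
rewrite (eq_filter (a2 := pred1 t.2)); last by move=> x; rewrite /= eq_sym.
by apply: filter_pred1_uniq; rewrite ?enumN_uniq // mem_enumN (hL t tL).
Qed.

Lemma degN_succ_vec (n : Zgr r) : mixed_index r d n -> degN (succ_vec n) = d.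
Proof.
move=> [n1 nd]; apply/eqP; rewrite -eqz_nat -nd /total_succ -degZ_toZ /degZ.
by apply/eqP/eq_bigr => i _; rewrite !ffunE; have := n1 i; lia.
Qed.

(** [mixed_mult] chooses among all decompositions: L provides one, and [weight_unique] shows that
    every other gives the same value. *)
Lemma mixed_multE H L (n : Zgr r) : of_degree d L -> (forall n, 0 <= weight L n) ->
  (forall nu, (H nu)%:Z = hilb_eval (id_window r) L nu) -> mixed_index r d n ->
  mixed_mult H d n = weight L (succ_vec n).
Proof.
move=> hL wL hH hn; rewrite /mixed_mult; case: (hn) => _ ->; rewrite eqxx.
have [Q hQ Q1] := exists_decomposition hL wL hH.
apply: xget_unique; first by exists Q.
move=> _ [Q' [_ hQ'] ->]; rewrite -weight_terms ?degN_succ_vec //.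
apply: (weight_unique (d := d)) => // [|nu]; first exact: of_degree_terms.
by rewrite hilb_eval_terms -hQ' hH.
Qed.

Lemma sum_mixed_mult H L : of_degree d L -> (forall n, 0 <= weight L n) ->
  (forall nu, (H nu)%:Z = hilb_eval (id_window r) L nu) ->
  \sum_(n \in mixed_index r d) mixed_mult H d n = sum_weight L.
Proof.
move=> hL wL hH; pose p (n : Ngr r) : Zgr r := [ffun i => (n i)%:Z - 1].
have sp n : succ_vec (p n) = n.
  by apply/ffunP => i; rewrite !ffunE subrK.
have ep : mixed_index r d = p @` [set` enumN].
  apply/seteqP; split=> [n hn|n' [n]].
    exists (succ_vec n); first by rewrite /= mem_enumN degN_succ_vec.
    by apply/ffunP => i; rewrite !ffunE; case: hn => /(_ i) + _; move: (n i) => x; lia.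
  rewrite /= mem_enumN => /eqP nd <-; split; first by move=> i; rewrite ffunE; lia.
  rewrite -nd -degZ_toZ /total_succ /degZ; apply: eq_bigr => i _.
  by rewrite !ffunE subrK.
rewrite ep fsbig_image; last by move=> n n' _ _ e; rewrite -[n]sp e sp.
rewrite -fsbig_seq ?enumN_uniq // -(sum_weight_by (S := enumN)) ?enumN_uniq //.
  rewrite big_seq [RHS]big_seq; apply: eq_bigr => n nN.
  by rewrite (mixed_multE hL wL hH) ?sp // ep; exists n.
by move=> t /hL td; rewrite mem_enumN td.
Qed.

Lemma multiplicityE (H : int -> nat) L : of_degree d L ->
  (forall k, (H k)%:Z = hilb_eval (total_window r) L k) ->
    multiplicity H d = sum_weight L.
Proof.
move=> hL hH.
have [Q hQ] := laurent_of [seq (t.1.1, degZ t.1.2) | t <- L].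
have Q1 : laurent1 Q = sum_weight L.
  rewrite /laurent1 /sum_weight; have := hQ (fun=> 1).
  rewrite big_map /=; under eq_bigr do rewrite mulr1; move=> ->.
  by apply: eq_bigr => t _; rewrite mulr1.
have hHQ k : (H k)%:Z = \sum_(l <- finsupp Q) Q l * (inv_coef d (k - l))%:Z.
  rewrite (hQ (fun l => (inv_coef d (k - l))%:Z)) big_map hH /hilb_eval.
  by rewrite big_seq [RHS]big_seq; apply: eq_bigr => t tL; rewrite /= (hL t tL).
apply: xget_unique; first by exists Q.
move=> _ [Q' hQ' ->]; rewrite -Q1.
(* For large K the value at 1 of a numerator is the coefficient of t^K in (1 - t)^(d-1) times the
   series, an expression in H alone. Two numerators are compared at a common K. *)
have lead (P : laurent int) : (forall k : int, (H k)%:Z =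
      \sum_(l <- finsupp P) P l * (inv_coef d (k - l))%:Z) ->
    exists C : nat, forall K J : nat, (d + C <= K)%N -> (K + C < J)%N ->
      laurent1 P = \sum_(j < J) pow_coef d j * (H (K%:Z - j%:Z))%:Z.
  move=> hP; exists (\max_(l <- finsupp P) `|l|)%N => K J KC JC.
  under [RHS]eq_bigr do rewrite hP mulr_sumr.
  rewrite exchange_big /laurent1 big_seq [RHS]big_seq; apply: eq_bigr => l lP.
  have lC := @leq_bigmax_seq _ (enum_fset (finsupp P)) xpredT (fun l : int =>
    `|l|%N) l lP isT.
  have := @convE d d (K%:Z - l) J (leqnn _); rewrite eqxx /conv => c.
  rewrite -[LHS]mulr1 -[X in _ * X]c; last 2 first.
  - by move: KC lC; set C := (\max_(_ <- _) _)%N; lia.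
  - by move: JC lC; set C := (\max_(_ <- _) _)%N; lia.
  by rewrite mulr_sumr; apply: eq_bigr => j _; rewrite mulrCA addrAC.
have [C hC] := lead _ hQ'; have [C' hC'] := lead _ hHQ.
pose K := (d + C + C')%N; pose J := (K + C + C').+1.
by rewrite (hC K J) ?(hC' K J) // /J /K; lia.
Qed.

End HilbertDecompositions.

(** * Hilbert functions of graded modules *)

Section GradedModules.
Variables (r : nat) (A : comNzRingType) (B : comAlgType A).
Variables (Bgr : Ngr r -> {pred B}) (M : lmodType B) (Mgr : Zgr r -> {pred M}).
Hypothesis artA : artinian A.
Hypothesis grB : graded_ring Bgr.
Hypothesis stdB : standard Bgr.
Hypothesis grM : graded_module Bgr Mgr.
Hypothesis fgM : mod_finitely_generated M.
Implicit Types (N U : set M) (p q : set B) (x b : B) (m : M).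
Implicit Types (i j : 'I_r) (nu mu : Zgr r) (al : Ngr r).

Local Notation dB := (grB_direct grB).
Lemma grM_direct : direct_sum Mgr. Proof. by case: grM. Qed.
Local Notation dM := grM_direct.
Local Notation Aops := (@scalars A B).
Local Notation asub := (@opsub B M Aops).
Local Notation bsub := (@opsub B M setT).

Lemma NZaddE al nu : NZadd al nu = toZ al + nu.
Proof. by apply/ffunP => i; rewrite !ffunE. Qed.

Lemma toZ_inj : injective (@toZ r).
Proof. by move=> a a' /ffunP e; apply/ffunP => i; have := e i; rewrite !ffunE => -[].
  Qed.

Lemma grM_scale al nu b m : b \in Bgr al -> m \in Mgr nu ->
  b *: m \in Mgr (toZ al + nu).
Proof. by case: grM => _ h hb hm; rewrite -NZaddE; apply: h. Qed.

Lemma gcmp_scale al x m nu : x \in Bgr al ->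
  gcmp dM (x *: m) nu = x *: gcmp dM m (nu - toZ al).
Proof.
move=> hx; move: m; apply: (graded_ind dM) => [k m hm||m m' e e'].
- rewrite (gcmp_hom dM _ (grM_scale hx hm)) (gcmp_hom dM _ hm).
  rewrite subr_eq addrC; case: eqP => _ //; by rewrite scaler0.
- by rewrite scaler0 !gcmp0 scaler0.
- by rewrite scalerDr !gcmpD e e' scalerDr.
Qed.

Lemma gcmp_scale_hom mu m f al : m \in Mgr mu ->
  gcmp dM (f *: m) (toZ al + mu) = gcmp dB f al *: m.
Proof.
move=> hm; move: f; apply: (graded_ind dB) => [k f hf||f f' e e'].
- rewrite (gcmp_hom dM _ (grM_scale hf hm)) (gcmp_hom dB _ hf).
  by rewrite (inj_eq (addIr mu)) (inj_eq toZ_inj); case: eqP; rewrite ?scale0r.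
- by rewrite scale0r !gcmp0 scale0r.
- by rewrite scalerDl !gcmpD e e' scalerDl.
Qed.

Lemma gcmp_multiple mu m b nu : m \in Mgr mu ->
  exists b', gcmp dM (b *: m) nu = b' *: m.
Proof.
move=> hm; move: b; apply: (graded_ind dB) => [k f hf||f f' [c e] [c' e']].
- rewrite (gcmp_hom dM _ (grM_scale hf hm)); case: eqP => _; first by exists f.
  by exists 0; rewrite scale0r.
- by exists 0; rewrite scale0r gcmp0.
- by exists (c + c'); rewrite scalerDl gcmpD e e' scalerDl.
Qed.

Lemma proj_scale (P Q : pred (Zgr r)) al x m : x \in Bgr al ->
  (forall nu, P (toZ al + nu) = Q nu) -> proj dM P (x *: m) = x *: proj dM Q m.
Proof.
move=> hx PQ; apply: (gcmp_ext (dG := dM)) => nu.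
rewrite gcmp_proj !(gcmp_scale _ _ hx) gcmp_proj -PQ [toZ al + _]addrC subrK.
by case: ifP; rewrite ?scaler0.
Qed.

Lemma scalar_deg0 (a : A) : (a%:A : B) \in Bgr [ffun=> 0%N].
Proof. by case: stdB => _ h _; apply/h; exists a. Qed.

Lemma toZ0 : toZ [ffun=> 0%N] = 0 :> Zgr r.
Proof. by apply/ffunP => i; rewrite !ffunE. Qed.

Lemma generated (S : {pred B}) : GRing.subalg_closed S ->
  (forall i x, x \in Bgr (Nstd i) -> x \in S) -> forall b, b \in S.
Proof.
case: stdB => _ _ [gs [hgs gen]] hS SE; apply: gen => // g /hgs [i]; exact: SE.
Qed.

Lemma gens_exist : exists gs : seq B, forall S : {pred B},
  GRing.subalg_closed S -> {subset gs <= S} -> forall b, b \in S.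
Proof. by case: stdB => _ _ [gs [_ gen]]; exists gs. Qed.

Lemma noetherianM : @acc B M setT setT.
Proof. exact: noetherian (artinian_acc artA) gens_exist fgM. Qed.

Lemma noetherianB : @acc B B^o setT setT.
Proof.
apply: (noetherian (M := B^o) (artinian_acc artA) gens_exist).
exists [:: 1] => N [N0 NZ] N1 b; rewrite -[b]addr0 -[b]mulr1.
by apply: NZ => //; apply: N1; rewrite inE.
Qed.

(** Multiplication never lowers the total degree, so the generators bound all degrees. This starts
    the recursion on windows in [decomposes_shift]. *)
Lemma bounded_below : exists b : int, forall m nu, degZ nu < b -> gcmp dM m nu = 0.
Proof.
case: fgM => vs gen.
have [b hb] : exists b : int, forall v, v \in vs -> forall nu, degZ nu < b ->
  gcmp dM v nu = 0.
  elim: vs {gen} => [|v vs [b hb]]; first by exists 0.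
  have [c hc] : exists c : int, forall nu, nu \in gsupp dM v -> c <= degZ nu.
    elim: (gsupp dM v) => [|a s [c hc]]; first by exists 0.
    exists (Num.min c (degZ a)) => nu; rewrite inE ge_min => /orP [/eqP ->|/hc ->] //.
    by rewrite lexx orbT.
  exists (Num.min b c) => u; rewrite inE => /orP [/eqP -> nu|/hb h nu].
    rewrite lt_min => /andP [_ lt]; apply: gcmp_out; apply: contraL lt => /hc.
    by rewrite leNgt.
  by rewrite lt_min => /andP [/h].
exists b => m; apply/(@pred_ofP _ [set m | forall nu, degZ nu < b -> gcmp dM m nu = 0]).
apply: gen; last by move=> v hv; apply/pred_ofP => nu; apply: hb.
apply: opsub_submod; split=> [nu _|m1 m2 h1 h2 nu lt|c m1 _ h1].
- by rewrite gcmp0.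
- by rewrite gcmpB h1 ?h2 // subrr.
move: c; apply: (graded_ind dB) => [al c hc nu lt|nu lt|c c' h h' nu lt].
- rewrite (gcmp_scale _ _ hc) h1 ?scaler0 // degZD degZN degZ_toZ.
  by apply: le_lt_trans lt; rewrite lerBlDr lerDl.
- by rewrite scale0r gcmp0.
- by rewrite scalerDl gcmpD h ?h' ?addr0.
Qed.

Definition graded_sub N : Prop := bsub N /\ forall m nu, N m -> N (gcmp dM m nu).

Lemma graded_sub_proj N P m : graded_sub N -> N m -> N (proj dM P m).
Proof.
by move=> [sN gN] Nm; apply: (opsub_sum _ sN) => nu _; apply: gN.
Qed.

Lemma graded_sub0 : graded_sub [set 0].
Proof. by split; [apply: opsub_set0|move=> m nu ->; apply: gcmp0]. Qed.

Lemma graded_subT : graded_sub setT. Proof. by split. Qed.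

Definition colon N m : set B := [set b | N (b *: m)].

Lemma opsub_colon N m : bsub N -> @opsub B B^o setT (colon N m).
Proof.
move=> sN; split; first by rewrite /colon /= scale0r; apply: opsub0 sN.
- by move=> x y hx hy; rewrite /colon /= scalerBl; apply: (opsubB sN).
- by move=> b x _ hx; rewrite /colon /= -scalerA; apply: (opsubZ sN).
Qed.

Definition gen_by N m : set M := addm N [set z | exists b, z = b *: m].

Lemma opsub_multiples m : bsub [set z | exists b, z = b *: m].
Proof.
split; first by exists 0; rewrite scale0r.
- by move=> _ _ [b ->] [c ->]; exists (b - c); rewrite scalerBl.
- by move=> b _ _ [c ->]; exists (b * c); rewrite scalerA.
Qed.

Lemma opsub_gen_by N m : bsub N -> bsub (gen_by N m).
Proof. by move=> sN; apply: opsub_addm => //; apply: opsub_multiples. Qed.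

Lemma gen_byl N m : N `<=` gen_by N m.
Proof. exact/addml/(opsub0 (opsub_multiples m)). Qed.

Lemma gen_by_mem N m : bsub N -> gen_by N m m.
Proof. by move=> sN; apply: (addmr (opsub0 sN)); exists 1; rewrite scale1r. Qed.

Lemma gen_by_min N N' m : bsub N' -> N `<=` N' -> N' m -> gen_by N m `<=` N'.
Proof. by move=> sN NN Nm; apply: (addm_sub sN) => // _ [b ->]; apply: (opsubZ sN). Qed.

Lemma graded_sub_gen_by N m mu : graded_sub N -> m \in Mgr mu ->
  graded_sub (gen_by N m).
Proof.
move=> [sN gN] hm; split; first exact: opsub_gen_by.
move=> _ nu [n [_ [Nn [b ->] ->]]]; rewrite gcmpD.
by have [b' ->] := gcmp_multiple b nu hm; apply: addmP; [apply: gN|exists b'].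
Qed.

(** Take (N' : m) maximal over homogeneous m in N outside N'. If g m is outside N', maximality gives
    (N' : g m) = (N' : m), so f g in (N' : m) forces f into it. With g homogeneous, g m stays among
    the competitors, and [homogeneous_prime] suffices. *)
Lemma associated_prime N' N : graded_sub N' -> graded_sub N -> ~ (N `<=` N') ->
  exists mu m, [/\ m \in Mgr mu, N m, ~ N' m & is_prime (colon N' m)].
Proof.
move=> [sN' gN'] [sN gN] nNN.
have [|q [_ _ [mu [m [hm Nm nm ->]]] qmax]] := @acc_max B B^o _ _ (fun I => exists mu m,
  [/\ m \in Mgr mu, N m, ~ N' m & I = colon N' m]) noetherianB.
  have [n Nn nn] : exists2 n, N n & ~ N' n.
    by apply: contrapT => h; apply: nNN => n Nn; apply: contrapT => nn; apply: h;
      exists n.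
  have [nu hnu] : exists nu, ~ N' (gcmp dM n nu).
    apply: contrapT => h; apply: nn; rewrite [n](gcmp_sum dM).
    by apply: (opsub_sum _ sN') => nu _; apply: contrapT => hnu; apply: h; exists nu.
  exists (colon N' (gcmp dM n nu)); first by split=> //; apply: opsub_colon.
  by exists nu, (gcmp dM n nu); split=> //; [apply: gcmp_mem|apply: gN].
exists mu, m; split=> //; apply: (homogeneous_prime (grB := grB)).
- exact: opsub_colon.
- by rewrite /colon /= scale1r.
- by move=> f al hf; rewrite /colon /= -(gcmp_scale_hom f al hm); apply: gN'.
- move=> f g a b hf hg hfg; have [?|ng] := pselect (colon N' m g); [by right|left].
  apply: (qmax (colon N' (g *: m))) => //.
  + exact: opsub_colon.
  + exists (toZ b + mu), (g *: m); split=> //; first exact: grM_scale.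
    exact: (opsubZ sN).
  + by move=> c hc; rewrite /colon /= scalerA mulrC -scalerA; apply: (opsubZ sN').
  + by rewrite /colon /= scalerA.
Qed.

(** The support of N / N': the class of n survives in the localization at p exactly when its
    annihilator lies in p. *)
Definition supp_in N' N p : Prop := is_prime p /\ exists2 n, N n & colon N' n `<=` p.

Lemma supp_inS N1 N2 N1' N2' p : N1' `<=` N1 -> N2 `<=` N2' ->
  supp_in N1 N2 p -> supp_in N1' N2' p.
Proof.
move=> h1 h2 [pp [n Nn np]]; split=> //; exists n; first exact: h2.
by move=> b hb; apply/np/h1.
Qed.

(** If some u outside p sends n into N2, then u n is an element of N2 whose annihilator modulo N1
    lies in p. *)
Lemma supp_in_split N1 N2 N3 p : bsub N2 ->
  supp_in N1 N3 p -> supp_in N1 N2 p \/ supp_in N2 N3 p.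
Proof.
move=> sN [pp [n Nn np]]; have [h|h] := pselect (colon N2 n `<=` p).
  by right; split=> //; exists n.
left; split=> //; have [u un nu] : exists2 u, colon N2 n u & ~ p u.
  by apply: contrapT => h'; apply: h => u hu; apply: contrapT => nu; apply: h';
    exists u.
exists (u *: n) => // b hb; have [_ _ pM] := pp.
by case: (pM b u) => //; apply: np; rewrite /colon /= -scalerA.
Qed.

Lemma supp_in_gen N m p : bsub N -> supp_in N (gen_by N m) p -> colon N m `<=` p.
Proof.
move=> sN [_ [_ [n [_ [Nn [b ->] ->]]] np]] u hu; apply: np.
rewrite /colon /= scalerDr scalerA mulrC -scalerA.
by apply: (opsubD sN); apply: (opsubZ sN).
Qed.

Lemma supp_in_quot N m x p : bsub N ->
  supp_in (gen_by N (x *: m)) (gen_by N m) p -> p x.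
Proof.
move=> sN [_ [_ [n [_ [Nn [b ->] ->]]] np]]; apply: np.
rewrite /colon /= scalerDr scalerA mulrC -scalerA.
by apply: addmP; [apply: (opsubZ sN)|exists b].
Qed.

Lemma supp_in_nonempty N' N : graded_sub N' -> graded_sub N -> ~ (N `<=` N') ->
  exists p, supp_in N' N p.
Proof.
move=> gN' gN /(associated_prime gN' gN) [mu [m [_ Nm _ qp]]].
by exists (colon N' m); split=> //; exists m.
Qed.

Section Regions.
Variable W : window r.
Implicit Type g : wT W.

Definition region g : set M := [set m | proj dM (wP g) m = m].

Lemma region_proj g m : region g (proj dM (wP g) m).
Proof. by rewrite /region /= proj_comp; apply: eq_proj => nu; rewrite andbb. Qed.

Lemma opsub_region g : asub (region g).
Proof.
split; first exact: proj0.
- by move=> m m' h h'; rewrite /region /= projB h h'.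
- move=> _ m [a ->] h; rewrite /region /= (proj_scale (Q :=
  wP g) m (scalar_deg0 a)) ?h //.
  by move=> nu; rewrite toZ0 add0r.
Qed.

Lemma region_low : exists b : int, forall g, wht g < b -> region g = [set 0].
Proof.
have [b hb] := bounded_below; exists b => g lt; apply/seteqP; split=> m.
  rewrite /region /= => <-; apply: (gcmp_ext (dG := dM)) => nu; rewrite gcmp0 gcmp_proj.
  by case: ifP => // /wP_ht le; apply: hb; apply: le_lt_trans lt.
by move=> ->; apply: proj0.
Qed.

Lemma region_scale j x g m : x \in Bgr (Nstd j) ->
  proj dM (wP g) (x *: m) = x *: proj dM (wP (wsh j g)) m.
Proof. by move=> hx; apply: (proj_scale _ hx) => nu; rewrite addrC; apply: wP_sh. Qed.

End Regions.

Lemma bsubA N : bsub N -> asub N.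
Proof. exact: opsubW. Qed.

(** Composition series are asserted rather than values of [lengthA], so that finiteness of the
    lengths is part of the induction. *)
Definition decomposes d (L : seq ((int * Zgr r) * Ngr r)) N' N : Prop :=
  [/\ of_degree d L, forall n, 0 <= weight L n & forall (W : window r) (g : wT W),
    exists2 h : nat, @comp_series B M Aops (N' `&` region g) (N `&` region g) h &
      h%:Z = hilb_eval W L g].

Lemma decomposes_nil d N : bsub N -> decomposes d [::] N N.
Proof.
move=> sN; split=> // [n|W g]; first by rewrite /weight big_nil.
exists 0%N; last by rewrite /hilb_eval big_nil.
apply: comp_series0; apply: opsubI; [exact: bsubA|exact: opsub_region].
Qed.

Lemma decomposes_cat d L L' N1 N2 N3 : decomposes d L N1 N2 -> decomposes d L' N2 N3 ->
  decomposes d (L ++ L') N1 N3.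
Proof.
move=> [d1 w1 h1] [d2 w2 h2]; split=> [|n|W g]; first exact: of_degree_cat.
  by rewrite weight_cat addr_ge0.
have [h c1 e1] := h1 W g; have [h' c2 e2] := h2 W g.
by exists (h + h')%N; [apply: comp_series_cat c1 c2|rewrite hilb_eval_cat PoszD e1 e2].
Qed.

Lemma decomposes_boost d L N' N j : decomposes d L N' N ->
  decomposes d.+1 (boostL j L) N' N.
Proof.
move=> [dL wL hL]; split=> [|n|W g]; first exact: of_degree_boost.
  by rewrite weight_boost.
by have [h c e] := hL W g; exists h; rewrite ?hilb_eval_boost.
Qed.

(** Put G = N + B m. As x is outside the prime (N : m), multiplication by x embeds G / N, translated
    by e_j, into G / N with cokernel G / (N + B x m). So the length in a window is that in its
    translate plus the length described by L. *)
Lemma decomposes_shift d L N mu m x j : graded_sub N -> m \in Mgr mu ->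
  is_prime (colon N m) ->
  x \in Bgr (Nstd j) -> ~ colon N m x ->
  decomposes d L (gen_by N (x *: m)) (gen_by N m) ->
    decomposes d.+1 (shiftL j L) N (gen_by N m).
Proof.
move=> gN hm qp hx nqx [dL wL hL]; have [sN _] := gN.
split=> [|n|W g]; first exact: of_degree_shift.
  have [nj|nj] := posnP (n j); first by rewrite weight_shift0.
  by have [n' /weight_shift ->] := Nadd_std nj.
have [b1 hb1] := region_low W; have [b2 hb2] := hilb_eval_low W (shiftL j L).
pose b := Num.min b1 b2.
have low g' : wht g' < b ->
  exists2 h : nat, comp_series Aops (N `&` region g') (gen_by N m `&` region g') h &
    h%:Z = hilb_eval W (shiftL j L) g'.
  rewrite lt_min => /andP [/hb1 e /hb2 ->]; exists 0%N => //; rewrite e.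
  have -> : N `&` [set 0] = [set 0].
    by apply/seteqP; split=> z [] // -> ; split=> //; apply: opsub0 sN.
  have -> : gen_by N m `&` [set 0] = [set 0].
    by apply/seteqP; split=> z [] // -> ; split=> //; apply: opsub0 (opsub_gen_by m sN).
  exact/comp_series0/opsub_set0.
(* Induction on the height of the window above a bound below which both sides vanish; a translation
   by e_j lowers the height by one. *)
have [k hk] : exists k : nat, wht g < b + k%:Z.
  by exists (absz (wht g - b)).+1; case: (wht g) (b) => [u|u] [v|v]; lia.
elim: k g hk => [|k IH] g hk; first by apply: low; rewrite addr0 in hk.
have [|h1 c1 e1] := IH (wsh j g); first by rewrite wht_sh; move: hk; lia.
have [h3 c3 e3] := hL W g.
exists (h1 + h3)%N; last by rewrite PoszD hilb_eval_shift e1 e3.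
apply: comp_series_cat c3; have sU : asub (N `&` region g) :=
  opsubI (bsubA sN) (opsub_region g).
have xB u v : x *: (u - v) = x *: u - x *: v :> M by apply: scalerBr.
have xZ c v : x *: (c *: v) = c *: (x *: v) :> M by rewrite !scalerA mulrC.
have xreg v : region (wsh j g) v -> region g (x *: v).
  by rewrite /region /= (region_scale _ _ hx) => ->.
have := comp_series_push xB xZ c1 sU; set V := addm _ _.
(* Multiplication by x carries the translated window into g, so the pushed series ends at the part
   of N + B x m in g. *)
have -> : V = gen_by N (x *: m) `&` region g.
  apply/seteqP; split.
    move=> _ [u [_ [[Nu ru] [v [[n' [_ [Nn' [c ->] ev]]] rv] <-] ->]]]; split.
      rewrite ev scalerDr addrA xZ; apply: addmP; last by exists c.
      by apply: (opsubD sN) => //; apply: (opsubZ sN).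
    by apply: (opsubD (opsub_region g)) => //; apply: xreg.
  move=> n' [[u [_ [Nu [c ->] e]]] rn]; rewrite -rn e projD -xZ (region_scale _ _ hx).
  apply: addmP; first by split; [apply: graded_sub_proj|apply: region_proj].
  exists (proj dM (wP (wsh j g)) (c *: m)) => //; split; last exact: region_proj.
  apply: graded_sub_proj; first exact: graded_sub_gen_by hm.
  by apply: (opsubZ (opsub_gen_by m sN)) => //; apply: gen_by_mem.
apply=> [_ [v [Nv rv] <-]|v [[u [_ [Nu [c ->] e]]] rv] [Nxv _]].
  by split; [apply: (opsubZ sN)|apply: xreg].
split=> //; rewrite e; apply: (opsubD sN) => //.
have : colon N m (x * c).
  apply: (opsub_addr (y := x *: u) sN); first exact: (opsubZ sN).
  by rewrite -scalerA -scalerDr addrC -e.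
by case: qp => _ _ pM /pM [].
Qed.

(** The elements congruent to a scalar modulo q form a subalgebra containing all generators. *)
Lemma residue_scalar q : is_prime q ->
  (forall k x, x \in Bgr (Nstd k) -> q x) -> forall b, exists a : A, q (b - a%:A).
Proof.
move=> [sq _ _] qE b; apply/(@pred_ofP _ [set b | exists a : A, q (b - a%:A)]).
apply: generated => [|k x /qE qx]; last by apply/pred_ofP; exists 0;
  rewrite scale0r subr0.
split.
- by apply/pred_ofP; exists 1; rewrite scale1r subrr; apply: opsub0 sq.
- move=> c u v /pred_ofP [a ha] /pred_ofP [a' ha']; apply/pred_ofP.
  exists (c * a + a'); rewrite scalerDl -scalerA opprD addrACA -scalerBr.
  apply: (opsubD sq) => //; rewrite -[c *: _]mul1r -scalerAr scalerAl.
  exact: (opsubZ (b := c%:A) sq).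
- move=> u v /pred_ofP [a ha] /pred_ofP [a' ha']; apply/pred_ofP; exists (a * a').
  have -> : u * v - (a * a')%:A = v * (u - a%:A) + a%:A * (v - a'%:A).
    by rewrite !mulrBr [v * u]mulrC -scalerA -(scalerAl a 1 a'%:A) mul1r
      [v * _]mulrC addrA subrK.
  by apply: (opsubD sq); [apply: (opsubZ (b := v) sq)|apply: (opsubZ (b := a%:A) sq)].
Qed.

(** From a^k = a^(k+1) b one gets a^k (b a - 1) = 0 in A, and no power of a lies in the prime q: the
    scalars modulo q form a field. *)
Lemma scalar_inverse q (a : A) : is_prime q -> ~ q a%:A ->
  exists b : A, q ((b * a - 1)%:A).
Proof.
move=> [sq q1 qM] na; have [k [b e]] := artinian_pow artA a; exists b.
have : q (a%:A ^+ k * (b * a - 1)%:A).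
  rewrite exprZn expr1n -scalerAl mul1r scalerA.
  rewrite (_ : a ^+ k * (b * a - 1) = 0) ?scale0r; first exact: opsub0 sq.
  by rewrite mulrBr mulr1 {2}e exprS mulrA mulrC mulrA subrr.
case/qM => // qk; exfalso; elim: k {e} qk => [|k IH]; first by rewrite expr0.
by rewrite exprS => /qM [].
Qed.

(** The factor is spanned by the class of m over the field of scalars modulo (N : m): it is simple
    in the windows containing mu and zero in the others. *)
Lemma decomposes_residue N mu m : graded_sub N -> m \in Mgr mu ->
  is_prime (colon N m) ->
  (forall k x, x \in Bgr (Nstd k) -> colon N m x) ->
  decomposes 0 [:: ((1, mu), [ffun=> 0%N])] N (gen_by N m).
Proof.
move=> gN hm qp qE; have [sN _] := gN; have [_ nq1 _] := qp; split.
- move=> t; rewrite inE => /eqP -> /=; rewrite /degN big1 // => i _.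
  by rewrite ffunE.
- by move=> n; rewrite /weight big_cons big_nil /=; case: ifP.
move=> W g; exists (wP g mu : nat); last first.
  by rewrite /hilb_eval big_cons big_nil /= wc0 addr0 mul1r.
have sNr := opsubI (bsubA sN) (opsub_region g).
have sGr := opsubI (bsubA (opsub_gen_by m sN)) (opsub_region g).
have dec z : gen_by N m z -> exists2 n, N n & exists a : A, z = n + a%:A *: m.
  move=> [n [_ [Nn [b ->] ->]]]; have [a ha] := residue_scalar qp qE b.
  exists (n + (b - a%:A) *: m); first exact: (opsubD sN).
  by exists a; rewrite -addrA -scalerDl subrK.
have sub1 : N `&` region g `<=` gen_by N m `&` region g.
  by move=> z [Nz rz]; split=> //; apply: gen_byl.
case: (boolP (wP g mu)) => hP; last first.
  rewrite (_ : gen_by N m `&` region g = N `&` region g); first exact: comp_series0.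
  apply/seteqP; split=> // z [/dec [n Nn [a e]] rz]; split=> //.
  rewrite -rz e projD (proj_scale (Q := wP g) m (scalar_deg0 a)); last first.
    by move=> nu; rewrite toZ0 add0r.
  by rewrite (proj_hom dM _ hm) (negPf hP) scaler0 addr0; apply: graded_sub_proj.
have rm : region g m by rewrite /region /= (proj_hom dM _ hm) hP.
have Am (a : A) : region g (a%:A *: m) by apply: (opsubZ (opsub_region g)) => //;
  exists a.
have {}dec z : (gen_by N m `&` region g) z ->
    exists2 n, (N `&` region g) n & exists a : A, z = n + a%:A *: m.
  move=> [/dec [n Nn [a e]] rz]; exists n; last by exists a.
  by split=> //; apply: (opsub_addr (y := a%:A *: m) (opsub_region g)) => //;
    rewrite -e.
apply: comp_series1; split=> //.
  have : (gen_by N m `&` region g) m by split=> //; apply: gen_by_mem.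
  by move=> h /(_ _ h) [Nm _]; apply: nq1; rewrite /colon /= scale1r.
move=> C sC NC CG; have [h|h] := pselect (C `<=` N `&` region g); [by left|right].
have [c Cc nc] : exists2 c, C c & ~ (N `&` region g) c.
  by apply: contrapT => h'; apply: h => c Cc; apply: contrapT => nc; apply: h';
    exists c.
have [n Nn [a e]] := dec _ (CG _ Cc).
have na : ~ colon N m a%:A.
  by move=> Na; apply: nc; rewrite e; apply: (opsubD sNr).
have [a' ha'] := scalar_inverse qp na.
have Cm : C m.
  have -> : m = a'%:A *: c - (a'%:A *: n + (a' * a - 1)%:A *: m).
    rewrite e scalerDr [_ + a'%:A *: _]addrC addrKA scalerA -scalerAl mul1r scalerA.
    by rewrite -!scalerBl subKr !scale1r.
  apply: (opsubB sC); first by apply: (opsubZ sC) => //; exists a'.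
  apply: NC; apply: (opsubD sNr); first by apply: (opsubZ sNr) => //; exists a'.
  by split; [exact: ha'|apply: Am].
move=> z /dec [n1 Nn1 [a1 ->]]; apply: (opsubD sC); first exact: NC.
by apply: (opsubZ sC) => //; exists a1.
Qed.

End GradedModules.

(** * Growth of the cumulative Hilbert function *)

Section Growth.
Variables (r : nat) (A : comNzRingType) (B : comAlgType A).
Variables (Bgr : Ngr r -> {pred B}) (M : lmodType B) (Mgr : Zgr r -> {pred M}).
Hypothesis grB : graded_ring Bgr.
Hypothesis stdB : standard Bgr.
Hypothesis grM : graded_module Bgr Mgr.
Implicit Types (N : set M) (p q : set B) (x b : B) (m : M).
Implicit Types (i j : 'I_r) (nu mu : Zgr r) (al : Ngr r).

Local Notation dB := (grB_direct grB).
Local Notation dM := (grM_direct grM).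
Local Notation Aops := (@scalars A B).
Local Notation asubB := (@opsub B B^o Aops).
Local Notation sub_chainB := (@sub_chain B B^o Aops).

(** The filtration by total degree replaces the grading because the primes of a chain need not be
    homogeneous. *)
Definition filt (K : nat) : set B^o := [set b | proj dB (fun al =>
  (degN al <= K)%N) b = b].

Lemma filtB K x y : filt K x -> filt K y -> filt K (x - y).
Proof. by rewrite /filt /= projB => -> ->. Qed.

Lemma filtD K x y : filt K x -> filt K y -> filt K (x + y).
Proof. by rewrite /filt /= projD => -> ->. Qed.

Lemma filt0 K : filt K 0. Proof. exact: proj0. Qed.

Lemma filt_hom K al x : x \in Bgr al -> (degN al <= K)%N -> filt K x.
Proof. by move=> hx le; rewrite /filt /= (proj_hom dB _ hx) le. Qed.

Lemma filt_ind K (P : B -> Prop) : P 0 -> (forall x y, P x -> P y -> P (x + y)) ->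
  (forall al x, x \in Bgr al -> (degN al <= K)%N -> P x) -> forall x, filt K x -> P x.
Proof.
move=> P0 PD Ph x; rewrite /filt /= => <-; apply: (big_ind P) => // al le.
exact: Ph (gcmp_mem _ _ _) le.
Qed.

Lemma filt_mul K J x y : filt K x -> filt J y -> filt (K + J) (x * y).
Proof.
move=> hx hy; move: x hx; apply: filt_ind => [|x x' h h'|al x hx le].
- by rewrite mul0r; apply: filt0.
- by rewrite mulrDl; apply: filtD.
move: y hy; apply: filt_ind => [|y y' h h'|be y hy le'].
- by rewrite mulr0; apply: filt0.
- by rewrite mulrDr; apply: filtD.
by apply: filt_hom (grB_mul grB hx hy) _; rewrite degN_add leq_add.
Qed.

Lemma filt_scalar (a : A) : filt 0 a%:A.
Proof.
apply: filt_hom (scalar_deg0 stdB a) _.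
by rewrite /degN big1 // => i _; rewrite ffunE.
Qed.

Lemma filtS K J : (K <= J)%N -> filt K `<=` filt J.
Proof.
move=> KJ; apply: filt_ind => [|x y|al x hx le]; [exact: filt0|exact: filtD|].
by apply: filt_hom hx _; apply: leq_trans KJ.
Qed.

Lemma filt_exhaust x : exists K, filt K x.
Proof.
move: x; apply: (graded_ind dB) => [al x hx||x y [K hK] [J hJ]].
- by exists (degN al); apply: filt_hom hx _.
- by exists 0%N; apply: filt0.
- exists (maxn K J); apply: filtD.
    by apply: filtS hK; rewrite leq_maxl.
  by apply: filtS hJ; rewrite leq_maxr.
Qed.

Lemma opsub_filt K : asubB (filt K).
Proof.
split; [exact: filt0|exact: filtB|].
by move=> _ b [a ->] hb; apply: (filt_mul (K := 0)) => //; apply: filt_scalar.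
Qed.

Lemma opsub_prime_filt p K : is_prime p -> asubB (p `&` filt K).
Proof.
move=> [sp _ _]; apply: opsubI; last exact: opsub_filt.
exact: (opsubW (O' := setT) _ sp).
Qed.

Lemma filt_chain0 p K : is_prime p -> sub_chainB (p `&` filt K) (filt K) 1.
Proof.
move=> pp; apply: (sub_chainS (opsub_filt K)) => //; last exact: sub_chain0.
have [_ p1 _] := pp; move=> /(_ 1) [] //.
by rewrite -(scale1r (1 : B)); apply: filtS (filt_scalar 1).
Qed.

(** As x lies in p' and outside p, multiplication by x embeds [filt K] modulo p into the part of p'
    in [filt (K + a)] modulo p; the chain modulo p' is stacked on top. *)
Lemma filt_chainS p p' x a K k k' : is_prime p -> is_prime p' -> p `<=` p' ->
  p' x -> ~ p x -> filt a x ->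
  sub_chainB (p `&` filt K) (filt K) k ->
  sub_chainB (p' `&` filt (K + a)) (filt (K + a)) k' ->
  sub_chainB (p `&` filt (K + a)) (filt (K + a)) (k + k').
Proof.
move=> pp pp' sp px' npx hx ch ch'.
have xB (u v : B^o) : x * (u - v) = x * u - x * v by apply: mulrBr.
have xZ (c : B) (v : B^o) : x * (c *: v) = c *: ((x * v) : B^o) by apply: mulrCA.
have xF u : filt K u -> filt (K + a) (x * u) by move=> hu; rewrite addnC;
  apply: filt_mul.
have [s1 s2 s3] := And3 (opsub_prime_filt K pp) (opsub_filt K) (opsub_prime_filt (K +
  a) pp).
apply: sub_chain_cat ch'.
apply: (@sub_chain_widen B B^o Aops _ (addm (p `&` filt (K + a)) ((fun u : B^o =>
  x * u) @` filt K))).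
  apply: (addm_sub (opsub_prime_filt (K + a) pp')) => [u [pu fu]|_ [u fu <-]].
    by split=> //; apply: sp.
  by split; [rewrite mulrC; apply: prime_mull|apply: xF].
apply: (@sub_chain_push B B^o B^o Aops _ xB xZ _ _ _ _ ch s1 s2 s3).
- by move=> _ [u [pu fu] <-]; split; [apply: prime_mull|apply: xF].
- by move=> u fu [pxu _]; split=> //; case: pp => _ _ /(_ _ _ pxu) [].
Qed.

(** The inequality for one inclusion adds up by Pascal's rule, whence the binomial coefficients. It
    is stated for all a >= a0 so that all inclusions of the chain can share one step width. *)
Lemma prime_chain_growth p d : prime_chain p d -> exists2 a0 : nat, (0 < a0)%N &
  forall a K, (a0 <= a)%N ->
    sub_chainB (p `&` filt (a * K)) (filt (a * K)) 'C(K + d, d).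
Proof.
elim=> [q hq|q q' k hq qq' nq'q hq' [a1 a10 IH]].
  by exists 1%N => // a K _; rewrite bin0; apply: filt_chain0.
have [x q'x nqx] : exists2 x, q' x & ~ q x.
  by apply: contrapT => h; apply: nq'q => x qx; apply: contrapT => nx; apply: h;
    exists x.
have [a2 ha2] := filt_exhaust x; exists (maxn a1 a2); first by rewrite leq_max a10.
move=> a K; rewrite geq_max => /andP [le1 le2].
elim: K => [|K IHK]; first by rewrite add0n binn; apply: filt_chain0.
have := IH a K.+1 le1; rewrite mulnS [(a + _)%N]addnC addSnnS addSn binS => ch.
exact: (filt_chainS hq (prime_chain_prime hq') qq' q'x nqx (filtS le2 ha2) IHK ch).
Qed.

(** The map sending b to b m embeds B / (N : m) into the factor. Elements of degree at most a K land
    in total degree at most a K + s, with s = |deg mu|, so the cumulative function grows too fast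
    for a vanishing total weight. *)
Lemma sum_weight_gen_by N mu m d L : opsub setT N -> m \in Mgr mu ->
  prime_chain (colon N m) d ->
  decomposes grM d L N (gen_by N m) -> sum_weight L <> 0.
Proof.
move=> sN hm hq [dL _ hL]; have [a a0 ha] := prime_chain_growth hq.
pose s := absz (degZ mu); apply: (@sum_weight_neq0 _ d L a s) => // K.
have [h ch <-] := hL (cumulative_window r) (a * K + s)%N%:Z.
rewrite lez_nat; apply: (comp_series_bound ch).
set g : wT (cumulative_window r) := (a * K + s)%N%:Z in ch *.
have fB (u v : B^o) : u *: m - v *: m = (u - v) *: m by rewrite scalerBl.
have fF b : filt (a * K) b -> region grM g (b *: m).
  move: b; apply: filt_ind => [|u v hu hv|al b hb le].
  - by rewrite scale0r; apply: opsub0 (opsub_region stdB grM g).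
  - by rewrite scalerDl; apply: (opsubD (opsub_region stdB grM g)).
  rewrite /region /= (proj_hom dM _ (grM_scale grM hb hm)) degZD degZ_toZ.
  rewrite (_ : _ <= _) // /g /s; move: le (degZ mu) => le z.
  have : (degN al)%:Z <= (a * K)%N%:Z by rewrite lez_nat.
  by rewrite PoszD; lia.
have pq := prime_chain_prime hq.
apply: (@sub_chain_widen _ _ _ _ (addm (N `&` region grM g) ((fun b : B^o =>
  b *: m) @` filt (a * K)))).
  apply: (addm_sub (opsubI (bsubA (opsub_gen_by m sN)) (opsub_region stdB grM g))).
    by move=> z [Nz rz]; split=> //; apply: gen_byl.
  move=> _ [b hb <-]; split; last exact: fF.
  by apply: (opsubZ (opsub_gen_by m sN)) => //; apply: gen_by_mem.
apply: (@sub_chain_push B B^o M Aops (fun b : B^o =>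
  b *: m) _ _ (colon N m `&` filt (a * K))).
- by move=> u v; rewrite scalerBl.
- by move=> b v; rewrite -scalerA.
- exact: ha.
- exact: opsub_prime_filt.
- exact: opsub_filt.
- by apply: opsubI; [apply: bsubA|apply: opsub_region].
- by move=> _ [b [qb fb] <-]; split=> //; apply: fF.
- by move=> b fb [].
Qed.

End Growth.

(** * Decomposition of the Hilbert series *)

Section Claim.
Variables (r : nat) (A : comNzRingType) (B : comAlgType A).
Variables (Bgr : Ngr r -> {pred B}) (M : lmodType B) (Mgr : Zgr r -> {pred M}).
Hypothesis artA : artinian A.
Hypothesis grB : graded_ring Bgr.
Hypothesis stdB : standard Bgr.
Hypothesis grM : graded_module Bgr Mgr.
Hypothesis fgM : mod_finitely_generated M.
Variable i : 'I_r.
Implicit Types (N : set M) (p q : set B) (x b : B) (m : M) (d : nat).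

Local Notation graded_sub := (graded_sub grM).
Local Notation decomposes := (decomposes grM).

Definition contains_deg (j : 'I_r) p : Prop := forall x, x \in Bgr (Nstd j) -> p x.

(* The last three clauses relate the weights at the [n] with [n i = 0] to the
   primes of dimension [d] in the support of [N / N'] containing the degree
   [e_i] part of B; the second one is only there to derive the third. *)
Definition adapted d N' N L : Prop :=
  [/\ decomposes d L N' N,
      (forall p, supp_in N' N p -> contains_deg i p -> ~ prime_chain p d) ->
        forall n : Ngr r, n i = 0%N -> weight L n = 0,
      (forall p, supp_in N' N p -> contains_deg i p) ->
        forall n : Ngr r, (0 < n i)%N -> weight L n = 0
    & (exists p, [/\ supp_in N' N p, contains_deg i p & prime_chain p d]) ->
        exists n : Ngr r, n i = 0%N /\ 0 < weight L n].

Definition dim_le d N' N : Prop :=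
  forall p k, supp_in N' N p -> prime_chain p k -> (k <= d)%N.

Lemma decomposes_iter_boost d L N' N : decomposes 0 L N' N ->
  decomposes d (iter d (boostL i) L) N' N.
Proof. by move=> h; elim: d => // d; apply: decomposes_boost. Qed.

(** A graded form of Nakayama's lemma: in degree mu, the multiple b x m only involves the component
    of b m in degree mu - e_j, which is 0 because B has no negative degrees. *)
Lemma not_gen_by_scale N mu m x j : graded_sub N -> m \in Mgr mu ->
  x \in Bgr (Nstd j) ->
  ~ colon N m 1 -> ~ gen_by N (x *: m) m.
Proof.
move=> [sN gN] hm hx nm [n [_ [Nn [b ->] e]]]; apply: nm.
have low c : gcmp (grM_direct grM) (c *: m) (mu - Zstd j) = 0.
  move: c; apply: (graded_ind (grB_direct grB)) => [al c hc||c c' h h'].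
  - rewrite (gcmp_hom _ _ (grM_scale grM hc hm)); case: eqP => // /ffunP /(_ j).
    by rewrite !ffunE eqxx; move: (mu j) => z; lia.
  - by rewrite scale0r gcmp0.
  - by rewrite scalerDl gcmpD h h' addr0.
rewrite /colon /= scale1r.
have <- : gcmp (grM_direct grM) m mu = m by rewrite (gcmp_hom _ _ hm) eqxx.
rewrite {1}e gcmpD scalerA mulrC -scalerA (gcmp_scale _ _ _ hx) low scaler0 addr0.
exact: gN.
Qed.

Lemma adapted_gen_by d N mu m : graded_sub N -> m \in Mgr mu -> is_prime (colon N m) ->
  dim_le d N (gen_by N m) ->
  (forall x d', ~ colon N m x -> graded_sub (gen_by N (x *: m)) ->
     dim_le d' (gen_by N (x *: m)) (gen_by N m) ->
     exists L, adapted d' (gen_by N (x *: m)) (gen_by N m) L) ->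
  exists L, adapted d N (gen_by N m) L.
Proof.
move=> gN hm qp dimd IH; set q := colon N m in qp.
have [sN _] := gN; have sG := opsub_gen_by m sN.
have sq : supp_in N (gen_by N m) q by split=> //; exists m => //; apply: gen_by_mem.
have gen p : supp_in N (gen_by N m) p -> q `<=` p by apply: supp_in_gen.
suff [L [gL PA PB1]] : exists L, [/\ decomposes d L N (gen_by N m),
    (forall p, supp_in N (gen_by N m) p -> contains_deg i p -> ~ prime_chain p d) ->
      forall n : Ngr r, n i = 0%N -> weight L n = 0 &
    (forall p, supp_in N (gen_by N m) p -> contains_deg i p) ->
      forall n : Ngr r, (0 < n i)%N -> weight L n = 0].
  (* The last clause follows from the others. By the dimension bound p equals q, so every prime of
     the support contains the part of degree e_i and the weights with n_i > 0 vanish; as the total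
     is nonzero, some weight with n_i = 0 is positive. *)
  exists L; split=> // -[p [sp ip hp]]; have qsp := gen p sp.
  have eqp : p = q.
    apply/seteqP; split=> //; apply: contrapT => npq.
    by have := dimd q d.+1 sq (prime_chainS qp qsp npq hp); rewrite ltnn.
  subst p; have w0 := PB1 (fun p hs x hx => gen p hs _ (ip x hx)).
  have tot := sum_weight_gen_by grB stdB sN hm hp gL; have [_ wL _] := gL.
  apply: contrapT => h; apply: tot.
  rewrite -(sum_weight_by (S := undup [seq t.2 | t <- L])) ?undup_uniq //; last first.
    by move=> t tL; rewrite mem_undup map_f.
  rewrite big1 // => n _; have [ni|ni] := posnP (n i); last exact: w0.
  apply/eqP; rewrite eq_le wL andbT leNgt; apply/negP => w; apply: h.
  by exists n.
have [qE|] := pselect (forall k, contains_deg k q).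
  (* Boosting makes all weights 0 if d > 0. If d = 0, the one weight sits at n = 0, and q itself
     violates the hypothesis of the vanishing clause for n_i = 0. *)
  exists (iter d (boostL i) [:: ((1, mu), [ffun=> 0%N])]); split.
  - by apply: decomposes_iter_boost; apply: decomposes_residue.
  - case: d {dimd} => [|d] h n _; last exact: weight_boost.
    by case: (h q sq (qE i)); apply: prime_chain0.
  - case: d {dimd} => [|d] _ n ni; last exact: weight_boost.
    rewrite /weight big_cons big_nil /=; case: eqP => // e.
    by move: ni; rewrite -e ffunE.
move=> nqE; have [j [x [hx nqx ji ij]]] : exists j x, [/\ x \in Bgr (Nstd j), ~ q x,
    contains_deg i q -> i != j & contains_deg i q \/ i = j].
  have [iq|niq] := pselect (contains_deg i q).
    have [j hj] : exists j, ~ contains_deg j q.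
      by apply: contrapT => h; apply: nqE => k; apply: contrapT => hk; apply: h;
        exists k.
    have [x hx nx] : exists2 x, x \in Bgr (Nstd j) & ~ q x.
      by apply: contrapT => h; apply: hj => x hx; apply: contrapT => nx; apply: h;
        exists x.
    by exists j, x; split; [| |move=> _; apply/negP => /eqP e; subst j|left].
  have [x hx nx] : exists2 x, x \in Bgr (Nstd i) & ~ q x.
    by apply: contrapT => h; apply: niq => x hx; apply: contrapT => nx; apply: h;
      exists x.
  by exists i, x; split=> //; right.
set N3 := gen_by N (x *: m).
have gN3 : graded_sub N3 by apply: graded_sub_gen_by gN (grM_scale grM hx hm).
have gG : graded_sub (gen_by N m) := graded_sub_gen_by grB gN hm.
have s3 p : supp_in N3 (gen_by N m) p -> [/\ is_prime p, q `<=` p & ~ (p `<=` q)].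
  move=> hs; split; first by case: hs.
    by apply: gen; apply: supp_inS hs => //; apply: gen_byl.
  by move=> pq; apply/nqx/pq/(supp_in_quot sN hs).
have s3' p k : supp_in N3 (gen_by N m) p -> prime_chain p k -> prime_chain q k.+1.
  by move=> /s3 [pp qp' npq]; apply: prime_chainS.
(* For d = 0 this case is empty: N + B x m is smaller than N + B m, so the support of the quotient
   has a prime, and it lies strictly above q. *)
case: d dimd => [|d] dimd.
  have [|p hs] := supp_in_nonempty artA grB stdB gN3 gG.
    by move=> h; apply: (not_gen_by_scale gN hm hx); [case: qp|apply/h/gen_by_mem].
  by have [pp _ _] := s3 p hs; have := dimd q 1%N sq (s3' p 0%N hs (prime_chain0 pp)).
have [|L [gL PA PB1 PB]] := IH x d nqx gN3.
  by move=> p k hs hk; rewrite -ltnS; apply: (dimd q) => //; apply: s3' hk.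
exists (shiftL j L); split.
- exact: (decomposes_shift grB stdB fgM gN hm qp hx nqx gL).
- move=> h n ni; have [e|ne] := eqVneq i j; first by subst j; apply: weight_shift0.
  have [nj|nj] := posnP (n j); first exact: weight_shift0.
  have [n' en] := Nadd_std nj; rewrite (weight_shift _ en); apply: PA; last first.
    by move: ni; rewrite en !ffunE (negPf ne) addn0.
  move=> p hs ip hp; case: ij => [iq|e]; last by rewrite e eqxx in ne.
  exact: (h q sq iq (s3' p d hs hp)).
- move=> h n ni; have iq := h q sq; have ne := ji iq.
  have [nj|nj] := posnP (n j); first exact: weight_shift0.
  have [n' en] := Nadd_std nj; rewrite (weight_shift _ en); apply: PB1; last first.
    by move: ni; rewrite en !ffunE (negPf ne) addn0.
  by move=> p /s3 [_ qp' _] y hy; apply/qp'/iq.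
Qed.

(** The induction runs on the lower end N' because both N / N2 and the factor left after dividing by
    x start at strictly larger submodules; d and N stay free, since the latter factor lowers the
    dimension bound. *)
Lemma adapted_exists N' : graded_sub N' -> forall d N, graded_sub N -> N' `<=` N ->
  dim_le d N' N -> exists L, adapted d N' N L.
Proof.
move=> gN'; have [sN' _] := gN'; move: N' sN' (@subsetT _ N') gN'.
apply: (acc_ind (noetherianM artA stdB fgM)) => N' sN' _ IH gN' d N gN NN dimd.
have [NN'|nNN] := pselect (N `<=` N').
  have -> : N = N' by apply/seteqP.
  exists [::]; split=> [|||[p [[[_ p1 _] [n Nn np]] _ _]]].
  - exact: decomposes_nil.
  - by move=> _ n _; rewrite /weight big_nil.
  - by move=> _ n _; rewrite /weight big_nil.
  - by case: p1; apply: np; rewrite /colon /= scale1r.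
have [mu [m [hm Nm nm qp]]] := associated_prime artA grB stdB gN' gN nNN.
have [sN _] := gN; set N2 := gen_by N' m.
have gN2 : graded_sub N2 := graded_sub_gen_by grB gN' hm.
have [sN2 _] := gN2; have N'N2 : N' `<=` N2 := @gen_byl _ _ _ N' m.
have N2N : N2 `<=` N by apply: gen_by_min.
have IH' N1 : graded_sub N1 -> N' `<=` N1 -> ~ (N1 `<=` N') ->
  forall d0 N0, graded_sub N0 ->
    N1 `<=` N0 -> dim_le d0 N1 N0 -> exists L, adapted d0 N1 N0 L.
  by move=> gN1 h1 h2; apply: IH => //; case: gN1.
have nN2 : ~ (N2 `<=` N') by move/(_ m (gen_by_mem m sN')).
have [L1 [gL1 PA1 PB11 PB1]] : exists L, adapted d N2 N L.
  apply: IH' => // p k hs; apply: dimd; exact: supp_inS hs.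
have [L2 [gL2 PA2 PB12 PB2]] : exists L, adapted d N' N2 L.
  apply: (adapted_gen_by gN' hm qp) => [p k hs|x d' nqx gN3 dim3].
    by apply: dimd; apply: supp_inS hs.
  apply: IH' dim3 => //; first exact: gen_byl.
    by move/(_ _ (gen_by_mem _ sN')).
  apply: gen_by_min; [exact: sN2|exact: N'N2|].
  by apply: (opsubZ sN2) => //; apply: gen_by_mem.
have [_ w1 _] := gL1; have [_ w2 _] := gL2.
exists (L2 ++ L1); split.
- exact: decomposes_cat gL2 gL1.
- move=> h n ni; rewrite weight_cat PA1 ?PA2 ?addr0 // => p hs; apply: h.
    exact: supp_inS hs.
  exact: supp_inS hs.
- move=> h n ni; rewrite weight_cat PB11 ?PB12 ?addr0 // => p hs; apply: h.
    exact: supp_inS hs.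
  exact: supp_inS hs.
- move=> [p [hs ip hp]]; have [h|h] := supp_in_split sN2 hs.
    have [|n [ni wn]] := PB2; first by exists p.
    by exists n; split=> //; rewrite weight_cat ltr_pwDl.
  have [|n [ni wn]] := PB1; first by exists p.
  by exists n; split=> //; rewrite weight_cat ltr_wpDl.
Qed.

End Claim.

(** * Lengths and dimensions of quotients *)

Lemma has_height_uniq (T : Type) (X : set {pred T}) n n' :
  has_height X n -> has_height X n' -> n = n'.
Proof.
move=> [[c hc] h] [[c' hc'] h']; apply/eqP; rewrite eqn_leq.
by rewrite (h' _ _ hc) (h _ _ hc').
Qed.

Section Length.
Variables (A : comNzRingType) (B : comAlgType A) (M : lmodType B).
Local Notation Aops := (@scalars A B).

Lemma A_submoduleP (N : {pred M}) : A_submodule N <-> @opsub B M Aops [set x | x \in N].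
Proof.
split=> [[N0 NZ]|[N0 NB NZ]].
- have NN x : x \in N -> - x \in N.
    by move=> Nx; have := NZ (-1) x 0 Nx N0; rewrite addr0 scaleN1r scaleN1r.
  split=> //= [x y Nx Ny|b x [a ->] Nx].
    by have := NZ 1 x (- y) Nx (NN _ Ny); rewrite scale1r scale1r.
  by have := NZ a x 0 Nx N0; rewrite addr0.
- split=> // a x y Nx Ny; apply: (@opsubD _ _ Aops [set x | x \in N]) => //.
  by apply: NZ => //; exists a.
Qed.

Lemma comp_series_fun U V n : @comp_series B M Aops U V n -> exists c : nat -> set M,
  [/\ forall i, (i <= n)%N -> opsub Aops (c i), c 0%N = U,
      forall i, (i <= n)%N -> c i `<=` V &
      forall i, (i < n)%N -> c i `<=` c i.+1 /\ ~ (c i.+1 `<=` c i)].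
Proof.
elim=> [U' sU|U' V' W k [sU sV UV nVU _] _ [c [c1 c0 c2 c3]]].
  by exists (fun=> U'); split=> // i _; apply: subset_refl.
exists (fun i => if i is j.+1 then c j else U'); split=> //.
- by case=> // i; apply: c1.
- case=> [_|i]; last exact: c2.
  by apply: subset_trans UV _; rewrite -c0; apply: c2.
- by case=> [_|i]; [rewrite c0|apply: c3].
Qed.

Lemma strict_subsetP (T : Type) (U V : set T) :
  strict_subset (pred_of U) (pred_of V) <-> U `<=` V /\ ~ (V `<=` U).
Proof.
split=> [[UV [x /pred_ofP Vx /pred_ofP nUx]]|[UV nVU]].
  split=> [y /(pred_ofP U) /UV /pred_ofP|] //.
  by move=> /(_ x Vx).
split=> [x /pred_ofP /UV ?|]; first exact/pred_ofP.
have [x Vx nx] : exists2 x, V x & ~ U x.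
  by apply: contrapT => h; apply: nVU => x Vx; apply: contrapT => nx; apply: h;
    exists x.
by exists x; [apply/pred_ofP|apply/negP => /pred_ofP].
Qed.

Lemma strict_subset_set (T : Type) (S S' : {pred T}) : strict_subset S S' ->
  [set x | x \in S] `<=` [set x | x \in S'] /\ ~ ([set x | x \in S']
    `<=` [set x | x \in S]).
Proof.
move=> [SS [x xS' xS]]; split=> [y|/(_ x xS')] /=; first exact: SS.
by apply/negP.
Qed.

(** A composition series is a longest chain, so the supremum in [lengthA] exists and the default
    value of [xget] does not occur. *)
Lemma lengthA_cs (V : {pred M}) n : @comp_series B M Aops [set 0] [set x | x \in V] n ->
  lengthA V = n.
Proof.
move=> csV; suff hV : has_height [set N : {pred M} | A_submodule N /\ {subset N <= V}]
  n.
  by apply: xget_unique => // k /(has_height_uniq hV).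
split.
  have [c [c1 c0 c2 c3]] := comp_series_fun csV; exists (fun i => pred_of (c i)).
  split=> i ik; last exact/strict_subsetP/c3.
  split; last by move=> x /pred_ofP /(c2 _ ik).
  apply/A_submoduleP; rewrite (_ : [set x | _] = c i); first exact: c1.
  by apply/seteqP; split=> x /=; [move/pred_ofP|move=> ?; apply/pred_ofP].
move=> k c [hc1 hc2]; apply: (comp_series_bound csV).
have s i : (i <= k)%N -> opsub Aops [set x | x \in c i].
  by move=> ik; apply/A_submoduleP; case: (hc1 i ik).
apply: (@sub_chainW _ _ _ [set x | x \in c 0%N]); first by move=> _ ->;
  apply: opsub0 (s 0%N isT).
suff h j i : (i + j = k)%N -> sub_chain Aops [set x | x \in c i] [set x | x \in V]
  j by exact: h.
elim: j i => [|j IH] i e.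
  by apply: sub_chain0; case: (hc1 i); rewrite -?e ?addn0.
have ik : (i < k)%N by rewrite -e addnS ltnS leq_addr.
have [h1 h2] := strict_subset_set (hc2 i ik).
by apply: sub_chainS h1 h2 (IH i.+1 _); [apply: s|rewrite addSnnS].
Qed.

End Length.

(** * Primes of a quotient ring *)

Section PrimeDimension.
Variable R : comNzRingType.

Lemma prime_chain_weaken (p q : set R) k : is_prime p -> p `<=` q ->
  prime_chain q k -> prime_chain p k.
Proof.
move=> pp pq h; case: h pq => [q' _ _|q' q'' n hq' qq nqq h pq];
  first exact: prime_chain0.
apply: (prime_chainS pp _ _ h); first exact: subset_trans qq.
by move=> h'; apply: nqq; apply: subset_trans pq.
Qed.

Variable P : prime_idealr R.
Local Notation Q := {ideal_quot P}.
Local Notation p := [set x | x \in (P : {pred R})].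

Lemma quot_pi_eq x y : (\pi_Q x = \pi_Q y)%qT <-> x - y \in (P : {pred R}).
Proof. by rewrite Quotient.idealrBE; split=> [/eqP|/eqP]. Qed.

Lemma prime_preim (q : set Q) : is_prime q -> is_prime [set x : R | q (\pi_Q x)%qT].
Proof.
move=> [sq q1 qM]; split.
- split=> /=; first by rewrite rmorph0; apply: opsub0 sq.
  + by move=> x y hx hy /=; rewrite rmorphB; apply: (opsubB sq).
  + move=> b x _ hx /=; rewrite [b *: x]/(b * x) rmorphM.
    exact: (opsubZ (b := (\pi_Q b)%qT) sq).
- by rewrite /= rmorph1.
- by move=> x y /=; rewrite rmorphM; apply: qM.
Qed.

Lemma preim_contains (q : set Q) : is_prime q -> p `<=` [set x : R | q (\pi_Q x)%qT].
Proof.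
move=> [sq _ _] x px /=; rewrite (_ : (\pi_Q x)%qT = 0); first exact: opsub0 sq.
by rewrite -[RHS](rmorph0 (\pi_Q)%qT); apply/quot_pi_eq; rewrite subr0.
Qed.

Lemma repr_pi (q : set R) x : is_prime q -> p `<=` q -> q (repr (\pi_Q x)%qT) <-> q x.
Proof.
move=> [sq _ _] pq; have h : q (x - repr (\pi_Q x)%qT).
  by apply/pq/quot_pi_eq; rewrite reprK.
split=> hx; first by rewrite -[x](subrK (repr (\pi_Q x)%qT)); apply: (opsubD sq).
by rewrite -[repr _](subKr x); apply: (opsubB sq).
Qed.

(** The image is described through canonical representatives; their choice is immaterial because q
    contains P. *)
Lemma prime_image (q : set R) : is_prime q -> p `<=` q ->
  is_prime [set y : Q | q (repr y)].
Proof.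
move=> qp pq; have [sq q1 qM] := qp.
have e (x : R) (y : Q) : (\pi_Q x)%qT = y -> q x <-> q (repr y).
  by move=> <-; split=> /(repr_pi x qp pq).
split.
- split=> /=; first by apply/(e 0); [rewrite rmorph0|apply: opsub0 sq].
  + move=> x y hx hy /=; apply/(e (repr x - repr y));
    first by rewrite rmorphB /= !reprK.
    exact: (opsubB sq).
  + move=> b x _ hx /=; apply/(e (repr b * repr x)); first by rewrite rmorphM /= !reprK.
    exact: (opsubZ (b := repr b) sq).
- by move=> /= h; apply: q1; apply/(e 1) => //; rewrite rmorph1.
- move=> x y /= h; apply: qM; apply/(e _ (x * y)) => //.
  by rewrite rmorphM /= !reprK.
Qed.

(** The preimage chain may start strictly above P, so its bottom is replaced by P. *)
Lemma quot_prime_chain k (c : nat -> {pred Q}) :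
  strict_chain [set S : {pred Q} | exists q : prime_idealr Q, S = q] k c ->
    prime_chain p k.
Proof.
move=> [hc1 hc2].
have hp i : (i <= k)%N -> is_prime [set y | y \in c i].
  by move=> /hc1 [q ->]; apply: is_prime_of.
pose c' i := [set x : R | (\pi_Q x)%qT \in c i].
apply: (@prime_chain_weaken _ (c' 0%N)).
- exact: is_prime_of.
- exact: preim_contains (hp 0%N isT).
apply: fun_prime_chain => i ik; first exact: prime_preim (hp i ik).
have [h [y yc ny]] := hc2 i ik; split=> [x|/(_ (repr y))]; first exact: h.
by rewrite /c' /= reprK => /(_ yc); apply/negP.
Qed.

Lemma krull_dim_quot d : (forall k, prime_chain p k -> (k <= d)%N) ->
  krull_dim Q d <-> prime_chain p d.
Proof.
move=> bnd; split=> [[[c hc] _]|hp]; first exact: quot_prime_chain hc.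
split; last by move=> k c /quot_prime_chain /bnd.
have [c [c0 c1 c2 c3]] := prime_chain_fun hp.
exists (fun i => pred_of [set y : Q | c i (repr y)]); split=> i ik.
  by have [q eq] := prime_of (prime_image (c1 i ik) (c2 i ik)); exists q.
apply/strict_subsetP; have [h h'] := c3 i ik; split=> [y|h2]; first exact: h.
apply: h' => x cx; have [ci ci1] := (c1 i (ltnW ik), c1 i.+1 ik).
apply/(repr_pi x ci (c2 i (ltnW ik))); apply: h2 => /=.
exact/(repr_pi x ci1 (c2 i.+1 ik)).
Qed.

End PrimeDimension.

(** The difference of the cross products of two distinct fractions has its annihilator inside P;
    conversely n / 1 differs from 0 / 1. *)
Lemma supp_inP (A : comNzRingType) (B : comAlgType A) (M : lmodType B)
  (P : prime_idealr B) :
  supp M P <-> supp_in [set 0] [set: M] [set x | x \in (P : {pred B})].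
Proof.
split=> [[x [y [x2 y2 ne]]]|[_ [n _ np]]].
  split; first exact: is_prime_of.
  exists (y.2 *: x.1 - x.2 *: y.1) => // u hu /=; apply: contrapT => nu.
  by apply: ne; exists u => //; apply/negP.
have P1 : 1 \notin (P : {pred B}) by rewrite idealr1.
exists (n, 1), (0, 1); split=> // -[u nu] /=; rewrite scaler0 subr0 scale1r => hu.
by move/negP: nu; apply; apply: np.
Qed.

(** * Primes containing the irrelevant ideal *)

Section Irrelevant.
Variables (r : nat) (A : comNzRingType) (B : comAlgType A).
Variables (Bgr : Ngr r -> {pred B}).
Hypothesis grB : graded_ring Bgr.
Hypothesis stdB : standard Bgr.
Implicit Type al : Ngr r.
Local Notation dB := (grB_direct grB).

Lemma gcmp_mul_prime (i : 'I_r) (p : set B) x y : is_prime p ->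
  (forall al, (0 < al i)%N -> p (gcmp dB x al)) ->
  (forall al, (0 < al i)%N -> p (gcmp dB y al)) ->
  forall al, (0 < al i)%N -> p (gcmp dB (x * y) al).
Proof.
move=> pp hx hy al ali; have sp := prime_sub pp.
rewrite (gcmp_sum dB x) (gcmp_sum dB y) mulr_suml gcmp_big.
apply: (opsub_sum (M := B^o) _ sp) => a _; rewrite mulr_sumr gcmp_big.
apply: (opsub_sum (M := B^o) _ sp) => b _.
rewrite (gcmp_hom dB _ (grB_mul grB (gcmp_mem _ _ _) (gcmp_mem _ _ _))).
case: eqP => [e|_]; last exact: opsub0 sp.
have [ai|ai] := posnP (a i); last by rewrite mulrC; apply: prime_mull (hx a ai).
by apply: prime_mull => //; apply: hy; move: ali; rewrite e ffunE ai.
Qed.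

(** The elements whose components of positive i-th degree all lie in p form a subalgebra containing
    all generators. *)
Lemma contains_deg_components (i : 'I_r) (p : set B) : is_prime p ->
  contains_deg Bgr i p -> forall x al, (0 < al i)%N -> p (gcmp dB x al).
Proof.
move=> pp ip x; have sp := prime_sub pp.
apply/(@pred_ofP _ [set x | forall al, (0 < al i)%N -> p (gcmp dB x al)]).
have sc a al : (0 < al i)%N -> p (gcmp dB a%:A al).
  move=> ali; rewrite (gcmp_hom dB _ (scalar_deg0 stdB a)); case: eqP => [e|_].
    by rewrite e ffunE in ali.
  exact: opsub0 sp.
apply: (generated stdB) => [|k y hy]; last first.
  apply/pred_ofP => al ali; rewrite (gcmp_hom dB _ hy); case: eqP => [e|_].
    move: ali; rewrite e ffunE; case: eqP => // ik _; apply: ip; rewrite ik.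
    exact: hy.
  exact: opsub0 sp.
split.
- by apply/pred_ofP => al ali; rewrite -(scale1r (1 : B)); apply: sc.
- move=> a u v /pred_ofP hu /pred_ofP hv; apply/pred_ofP => al ali.
  rewrite gcmpD; apply: (opsubD sp); last exact: hv.
  rewrite -[u]mul1r scalerAl.
  by apply: (gcmp_mul_prime pp _ hu ali) => be; apply: sc.
- move=> u v /pred_ofP hu /pred_ofP hv; apply/pred_ofP.
  exact: gcmp_mul_prime pp hu hv.
Qed.

(** If every degree e_i had an element outside P, the product of these would be homogeneous with all
    degrees positive, and outside P as well. *)
Lemma V_irrelevantP (P : prime_idealr B) : V_irrelevant Bgr P <->
  exists i, contains_deg Bgr i [set x | x \in (P : {pred B})].
Proof.
have pp := is_prime_of P; set p := [set x | _] in pp *; have [sp p1 pM] := pp.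
split=> [hV|[i ip] x /(sum_componentsP dB) <-]; last first.
  suff : p (proj dB (fun n => [forall k, (0 < n k)%N]) x) by [].
  apply: (opsub_sum (M := B^o) _ sp) => al /forallP /(_ i).
  exact: contains_deg_components.
apply: contrapT => h.
have /choice [f hf] i : exists x, x \in Bgr (Nstd i) /\ ~ p x.
  apply: contrapT => h'; apply: h; exists i => x hx; apply: contrapT => nx.
  by apply: h'; exists x.
have [al [hal ali np]] : exists al : Ngr r, [/\
  \prod_(i <- index_enum 'I_r) f i \in Bgr al,
    forall i, i \in index_enum 'I_r -> (0 < al i)%N &
    ~ p (\prod_(i <- index_enum 'I_r) f i)].
  elim: (index_enum _) => [|j s [al [hal ali np]]].
    by exists [ffun=> 0%N]; rewrite big_nil; split=> //; case: grB.
  have [fj nfj] := hf j.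
  exists (Nadd (Nstd j) al); rewrite big_cons; split.
  - exact: grB_mul.
  - move=> i; rewrite inE !ffunE; case: eqP => //= _ /ali; lia.
  - by case/pM.
apply/np/hV/(sum_componentsP dB); rewrite (proj_hom dB _ hal).
by rewrite (_ : [forall k, _]) //; apply/forallP => i; apply: ali;
  rewrite mem_index_enum.
Qed.

End Irrelevant.

(** * The sum formula and the criterion for M *)

Theorem theorem2p8 (r : nat) (A : comNzRingType) (B : comAlgType A)
    (Bgr : Ngr r -> {pred B}) (M : lmodType B) (Mgr : Zgr r -> {pred M})
    (d : nat) :
  (0 < r)%N ->
  artinian A -> local_ring A ->
  graded_ring Bgr -> standard Bgr ->
  graded_module Bgr Mgr -> mod_finitely_generated M ->
  mod_dim M d ->
  multiplicity_gr Mgr d =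
    \sum_(n \in mixed_index r d)
       mixed_multiplicity Mgr d n
  /\
  ([set p : prime_idealr B | supp M p /\ krull_dim {ideal_quot p} d]
     `&` [set p : prime_idealr B | V_irrelevant Bgr p] !=set0 <->
   exists n : Zgr r, [/\ mixed_index r d n, ~ ge_vec n 0
     & 0 < mixed_multiplicity Mgr d n]).
Proof.
move=> r0 artA _ grB stdB grM fgM [_ dimM].
have dimd : dim_le d [set 0] [set: M].
  move=> p k [pp [n _ np]] /prime_chain_fun [c [c0 c1 c2 c3]].
  apply: (dimM k (fun i => pred_of (c i))); split=> i ik; last exact/strict_subsetP/c3.
  have [P eP] := prime_of (c1 i ik); exists P => //; apply/supp_inP.
  split; first exact: is_prime_of.
  by exists n => // x /np /(c2 i ik) cx; rewrite /= eP; apply/pred_ofP.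
have claim i := adapted_exists artA grB stdB fgM i (graded_sub0 grM) (graded_subT grM)
  (@subsetT _ _) dimd.
have hilbE L : decomposes grM d L [set 0] setT -> forall nu,
    (hilb Mgr nu)%:Z = hilb_eval (id_window r) L nu.
  move=> [_ _ hL] nu; have [h ch <-] := hL (id_window r) nu; congr Posz.
  apply: lengthA_cs; apply: comp_series_eq ch.
    by apply/seteqP; split=> x [] // -> ; split=> //;
      apply: opsub0 (opsub_region stdB grM _).
  rewrite setTI; apply/seteqP; split=> x /= hx.
    rewrite (_ : x = gcmp (grM_direct grM) x nu); first exact: gcmp_mem.
    apply: (gcmp_ext (dG := grM_direct grM)) => j; rewrite -{1}hx gcmp_proj.
    by rewrite (gcmp_hom _ _ (gcmp_mem _ _ _)) /=; case: eqP => // ->.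
  by rewrite /region /= (proj_hom _ _ hx) /= eqxx.
have hilb_grE L : decomposes grM d L [set 0] setT -> forall k,
    (hilb_gr Mgr k)%:Z = hilb_eval (total_window r) L k.
  move=> [_ _ hL] k; have [h ch <-] := hL (total_window r) k; congr Posz.
  apply: lengthA_cs; apply: comp_series_eq ch.
    by apply/seteqP; split=> x [] // -> ; split=> //;
      apply: opsub0 (opsub_region stdB grM _).
  by rewrite setTI; apply/seteqP; split=> x /= /(sum_componentsP (grM_direct grM)).
split.
  (* Any index i serves for the sum formula. *)
  have [L [gL _ _ _]] := claim (Ordinal r0); have [dL wL _] := gL.
  rewrite /multiplicity_gr (multiplicityE dL (hilb_grE L gL)).
  by rewrite (sum_mixed_mult dL wL (hilbE L gL)).
have bnd (P : prime_idealr B) : supp M P ->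
    forall k, prime_chain [set x | x \in (P : {pred B})] k -> (k <= d)%N.
  by move=> /supp_inP sP k; apply: dimd.
split=> [[P [[sP kP] /(V_irrelevantP grB stdB) [i iP]]]|[n [hn nn wn]]].
  have [L [gL _ _ [|n [ni wn]]]] := claim i.
    exists [set x | x \in (P : {pred B})]; split=> //; first exact/supp_inP.
    by apply/(krull_dim_quot (bnd P sP)).
  have [dL wL _] := gL.
  have nd : degN n = d by apply: contrapT => h; rewrite (weight_out dL h) ltxx in wn.
  (* Mixed multiplicities are indexed by n - 1, so the zero entry of n at i becomes -1. *)
  pose n' : Zgr r := [ffun k => (n k)%:Z - 1].
  have sn : succ_vec n' = n by apply/ffunP => k; rewrite !ffunE subrK.
  have hn' : mixed_index r d n'.
    split; first by move=> k; rewrite ffunE; lia.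
    rewrite -nd -degZ_toZ /total_succ /degZ; apply: eq_bigr => k _.
    by rewrite !ffunE subrK.
  exists n'; split=> //; first by move=> /(_ i); rewrite ffunE ni.
  by rewrite /mixed_multiplicity (mixed_multE dL wL (hilbE L gL)) // sn.
have [i ni] : exists i, n i < 0.
  by apply: contrapT => h; apply: nn => i; rewrite leNgt; apply/negP => ?; apply: h;
    exists i.
have [L [gL PA _ _]] := claim i; have [dL wL _] := gL.
move: wn; rewrite /mixed_multiplicity (mixed_multE dL wL (hilbE L gL)) // => wn.
(* Otherwise the second clause of [adapted] would give weight 0 at n + 1, whose i-th entry is 0
   because n_i = -1. *)
have [p [sp ip hp]] : exists p, [/\ supp_in [set 0] [set: M] p, contains_deg Bgr i p &
  prime_chain p d].
  apply: contrapT => h; move: wn; rewrite PA ?ltxx //.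
    by move=> p sp ip hp; apply: h; exists p.
  by rewrite ffunE; have := hn.1 i; move: ni; move: (n i) => x; lia.
have [P eP] := prime_of (prime_chain_prime hp).
have ep : [set x | x \in (P : {pred B})] = p.
  by apply/seteqP; split=> x; rewrite /= eP => /pred_ofP.
have sP : supp M P by apply/supp_inP; rewrite ep.
exists P; split; first by split=> //; apply/(krull_dim_quot (bnd P sP)); rewrite ep.
by apply/(V_irrelevantP grB stdB); exists i; rewrite ep.
Qed.
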